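(* Let $\Psi$ be a Kempf-Ness function for $(\mathscr{M},G,K)$. A point $x\in\mathscr{M}$ is $G$-stable if and only if it is $T^{\mathbb C}$-stable for any compact torus $T\subset K$.
   Context: Setting. $K$ is a compact connected Lie group with Lie algebra $\mathfrak{k}$, $G=K^{\mathbb C}$ its complexification, with Lie algebra $\mathfrak{g}=\mathfrak{k}\oplus i\mathfrak{k}$. $\mathscr{M}$ is a Hausdorff topological space with a continuous action $G\times\mathscr{M}\to\mathscr{M}$. $G_x$ is the stabilizer of $x$ and $\mathfrak{g}_x$ its Lie algebra. Fix an $\operatorname{Ad}$-invariant scalar product on $\mathfrak{k}$; let $X=G/K$ with the corresponding $G$-invariant Riemannian metric (so that, with $o=K\in X$, the map $\mathfrak{k}\to T_oX$, $v\mapsto \frac{d}{dt}|_{t=0}\exp(itv)K$ is an isometry). Kempf-Ness function. A Kempf-Ness function for $(\mathscr{M},G,K)$ is a function $\Psi:\mathscr{M}\times G\to\mathbb{R}$ such that: (P1) for every $x$, $\Psi(x,\cdot)$ is smooth on $G$; (P2) $\Psi(x,kg)=\Psi(x,g)$ for all $k\in K$, $g\in G$; (P3) for all $x\in\mathscr{M}$, $v\in\mathfrak{k}$, $t\in\mathbb{R}$, $\frac{d^2}{dt^2}\Psi(x,\exp(itv))\ge 0$, and $\frac{d^2}{dt^2}\big|_{t=0}\Psi(x,\exp(itv))=0$ if and only if $\exp(\mathbb{C}v)\subset G_x$; (P4) $\Psi(x,g)+\Psi(gx,h)=\Psi(x,hg)$ for all $x$ and all $g,h\in G$; (P5) for every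 $x$ the function $\psi_x:X\to\mathbb{R}$, $\psi_x(gK):=\Psi(x,g^{-1})$ (well defined by (P2)), is globally Lipschitz; (P6) the map $\mathfrak{F}:\mathscr{M}\to\mathfrak{k}^*$ defined by $\langle\mathfrak{F}(x),v\rangle=\frac{d}{dt}\big|_{t=0}\Psi(x,\exp(itv))$ is continuous. $\mathfrak{F}$ is called the momentum mapping. Stability. $x$ is ($G$-)stable if $G\cdot x\cap\mathfrak{F}^{-1}(0)\ne\emptyset$ and $\mathfrak{g}_x$ is conjugate (under $\operatorname{Ad}(G)$) to a subalgebra of $\mathfrak{k}$. Restriction to subgroups. If $K'\subset K$ is a closed connected subgroup and $G'=(K')^{\mathbb C}\subset G$, then $\Psi|_{\mathscr{M}\times G'}$ is a Kempf-Ness function for $(\mathscr{M},G',K')$, with momentum mapping $\mathfrak{F}^{K'}(x)=\mathfrak{F}(x)|_{\mathfrak{k}'}$; $G'$-stability means stability with respect to this Kempf-Ness function. Thus for a torus $T\subset K$, $x$ is $T^{\mathbb C}$-stable if there is $g\in T^{\mathbb C}$ with $\mathfrak{F}(gx)|_{\mathfrak{t}}=0$ and the Lie algebra of the stabilizer of $x$ in $T^{\mathbb C}$ is conjugate in $\mathfrak{t}^{\mathbb C}$ to a subalgebra of $\mathfrak{t}$. *)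

(* Defs.v *)
From HB Require Import structures.
From mathcomp Require Import all_boot all_order all_algebra.
From mathcomp Require Import all_classical all_reals all_analysis.

Set Implicit Arguments.
Unset Strict Implicit.
Unset Printing Implicit Defensive.

Import Order.TTheory GRing.Theory Num.Theory.
Import numFieldNormedType.Exports.

Local Open Scope classical_set_scope.
Local Open Scope ring_scope.

HB.mixin Record isTopologicalGroup G of Group G & Topological G := {
  mulg_continuous : continuous (fun p : G * G => (p.1 * p.2)%g) ;
  invg_continuous : continuous (fun g : G => (g^-1)%g) }.

#[short(type="topologicalGroupType")]
HB.structure Definition TopologicalGroup :=
  { G of Group G & Topological G & isTopologicalGroup G }.

(* All the model spaces below are finite dimensional, and for these, on an open
   set, iterated directional derivatives give the usual classes C^k. *)
Fixpoint Ck (R : realType) (V W : normedModType R) (k : nat)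
    (U : set V) (f : V -> W) : Prop :=
  if k is k'.+1 then
    (forall x v, U x -> derivable f x v) /\
    (forall v, Ck k' U (fun x => 'D_v f x))
  else forall x, U x -> {for x, continuous f}.

Definition smooth_on (R : realType) (V W : normedModType R)
    (U : set V) (f : V -> W) : Prop := forall k, Ck k U f.

(* Holomorphy, V and W being complex vector spaces through JV and JW. *)
Definition holomorphic_on (R : realType) (V W : normedModType R)
    (JV : V -> V) (JW : W -> W) (U : set V) (f : V -> W) : Prop :=
  smooth_on U f /\ forall x v, U x -> 'D_(JV v) f x = JW ('D_v f x).

(* C^n = R^n (+) i R^n : the pair (u, v) stands for u + i v. *)
Definition Cvec (R : realType) (n : nat) : normedModType R :=
  ('rV[R]_n * 'rV[R]_n)%type.

Definition Jc (R : realType) (n : nat) (x : Cvec R n) : Cvec R n :=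
  (- x.2, x.1).

Definition Jc2 (R : realType) (n : nat) (p : Cvec R n * Cvec R n) :
  Cvec R n * Cvec R n := (Jc p.1, Jc p.2).

Record chart (R : realType) (n : nat) (G : topologicalType) := Chart {
  cdom : set G ;
  cimg : set (Cvec R n) ;
  cmap : G -> Cvec R n ;
  cinv : Cvec R n -> G ;
  cdom_open : open cdom ;
  cimg_open : open cimg ;
  cmapP : forall p, cdom p -> cimg (cmap p) /\ cinv (cmap p) = p ;
  cinvP : forall u, cimg u -> cdom (cinv u) /\ cmap (cinv u) = u ;
  cmap_continuous : forall p, cdom p -> {for p, continuous cmap} ;
  cinv_continuous : forall u, cimg u -> {for u, continuous cinv} }.

Record complex_Lie_group (R : realType) (n : nat) (G : topologicalGroupType)
    (A : set (chart R n G)) : Prop := ComplexLieGroup {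
  clg_hausdorff : hausdorff_space G ;
  clg_countable : @second_countable G ;
  clg_cover : forall g : G, exists2 a, A a & cdom a g ;
  clg_compat : forall a b, A a -> A b ->
    holomorphic_on (@Jc R n) (@Jc R n)
      [set u | cimg a u /\ cdom b (cinv a u)]
      (fun u => cmap b (cinv a u)) ;
  clg_mul : forall a b c, A a -> A b -> A c ->
    holomorphic_on (@Jc2 R n) (@Jc R n)
      [set p | [/\ cimg a p.1, cimg b p.2
                 & cdom c (cinv a p.1 * cinv b p.2)%g]]
      (fun p => cmap c (cinv a p.1 * cinv b p.2)%g) ;
  clg_inv : forall a b, A a -> A b ->
    holomorphic_on (@Jc R n) (@Jc R n)
      [set u | cimg a u /\ cdom b (cinv a u)^-1%g]
      (fun u => cmap b (cinv a u)^-1%g) }.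

Section LieTheory.
Variables (R : realType) (n : nat) (G : topologicalGroupType).
Variable A : set (chart R n G).

Definition smooth_fun (f : G -> R) : Prop :=
  forall a, A a -> smooth_on (cimg a) (fun u => f (cinv a u)).

Definition smooth_curve (c : R -> G) : Prop :=
  continuous c /\
  forall a, A a -> smooth_on (c @^-1` cdom a) (fun t => cmap a (c t)).

(* e is the exponential map of G, the Lie algebra T_1 G being identified with
   R^n (+) i R^n by the differential of e at 0, which is only required to be a
   complex linear isomorphism. Every complex Lie group of dimension n has such
   a map, unique up to the choice of a complex basis of its Lie algebra. *)
Record exponential (e : Cvec R n -> G) : Prop := Exponential {
  exp_continuous : continuous e ;
  exp_holomorphic : forall a, A a ->
    holomorphic_on (@Jc R n) (@Jc R n)
      (e @^-1` cdom a) (fun xi => cmap a (e xi)) ;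
  exp_add : forall (s t : R) xi,
    e ((s + t) *: xi) = (e (s *: xi)%R * e (t *: xi)%R)%g ;
  exp_diff0 : forall a, A a -> cdom a 1%g ->
    bijective (fun xi => 'D_xi (fun z => cmap a (e z)) 0) }.

Variable e : Cvec R n -> G.

(* c'(0) = xi in T_1 G, for a curve c with c(0) = 1 *)
Definition has_velocity (c : R -> G) (xi : Cvec R n) : Prop :=
  forall a, A a -> cdom a 1%g ->
    is_derive (0 : R) (1 : R) (fun t => cmap a (c t))
      ('D_xi (fun z => cmap a (e z)) 0).

Definition velocity (c : R -> G) : Cvec R n := xget 0 (has_velocity c).

Definition Ad (g : G) (xi : Cvec R n) : Cvec R n :=
  velocity (fun t => (g * e (t *: xi)%R * g^-1)%g).

(* the Lie algebra of a closed subgroup H *)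
Definition lie_algebra (H : set G) : set (Cvec R n) :=
  [set xi | forall t : R, H (e (t *: xi))].

Definition exp_i (v : 'rV[R]_n) : G := e (0, v).

Definition subgroup (H : set G) : Prop :=
  [/\ H 1%g, forall g h, H g -> H h -> H (g * h)%g
    & forall g, H g -> H (g^-1)%g].

(* G = K^C : the compact connected Lie group K is a real form of G. The Lie
   algebra of K is the real part R^n (+) 0 of that of G, and (polar
   decomposition) (k, v) |-> k exp(iv) is a homeomorphism from K x Lie(K) to G,
   with inverse (kappa, rho). *)
Record complexification (K : set G) : Prop := Complexification {
  cplx_subgroup : subgroup K ;
  cplx_compact : compact K ;
  cplx_connected : connected K ;
  cplx_lie : forall xi, lie_algebra K xi <-> xi.2 = 0 ;
  cplx_polar : exists (kappa : G -> G) (rho : G -> 'rV[R]_n),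
    [/\ continuous kappa, continuous rho,
        forall g, K (kappa g) /\ g = (kappa g * exp_i (rho g))%g
      & forall k v, K k ->
          kappa (k * exp_i v)%g = k /\ rho (k * exp_i v)%g = v] }.

Record Ad_invariant_product (K : set G) (ip : 'rV[R]_n -> 'rV[R]_n -> R) :
    Prop := AdInvariantProduct {
  ip_sym : forall v w, ip v w = ip w v ;
  ip_linear : forall (r : R) u v w, ip (r *: u + v) w = r * ip u w + ip v w ;
  ip_pos : forall v, v != 0 -> 0 < ip v v ;
  ip_Ad : forall k v w, K k ->
    ip (Ad k (v, 0)).1 (Ad k (w, 0)).1 = ip v w }.

(* The Riemannian distance of gK and hK in X = G / K. A curve in X is lifted to
   a curve c in G; the speed of t |-> c(t) K is the norm of the component along
   i Lie(K) of the left logarithmic derivative c(t)^-1 c'(t). *)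
Definition X_dist (K : set G) (ip : 'rV[R]_n -> 'rV[R]_n -> R) (g h : G) : R :=
  inf [set l | exists c : R -> G,
    [/\ smooth_curve c, K (g^-1 * c 0%R)%g, K (h^-1 * c 1%R)%g
      & l = \int[lebesgue_measure]_(t in `[0, 1])
              (let v := (velocity (fun s => ((c t)^-1 * c (t + s)%R)%g)).2 in
               Num.sqrt (ip v v))]].

Record group_action (M : topologicalType) (act : G -> M -> M) : Prop :=
    GroupAction {
  act1 : forall x, act 1%g x = x ;
  actM : forall g h x, act (g * h)%g x = act g (act h x) ;
  act_continuous : continuous (fun p : G * M => act p.1 p.2) }.

(* <F(x), v> *)
Definition momentum (M : Type) (Psi : M -> G -> R) (x : M) (v : 'rV[R]_n) : R :=
  derive1 (fun t : R => Psi x (exp_i (t *: v))) 0.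

Record Kempf_Ness (M : topologicalType) (act : G -> M -> M) (K : set G)
    (ip : 'rV[R]_n -> 'rV[R]_n -> R) (Psi : M -> G -> R) : Prop := KempfNess {
  KN_smooth : forall x, smooth_fun (Psi x) ;
  KN_invariant : forall x k g, K k -> Psi x (k * g)%g = Psi x g ;
  KN_convex : forall x v t,
    0 <= derive1n 2 (fun t : R => Psi x (exp_i (t *: v))) t ;
  KN_degenerate : forall x v,
    derive1n 2 (fun t : R => Psi x (exp_i (t *: v))) 0 = 0 <->
    (forall a b : R, act (e (a *: v, b *: v)) x = x) ;
  KN_cocycle : forall x g h, Psi x g + Psi (act g x) h = Psi x (h * g)%g ;
  KN_lipschitz : forall x, exists L : R, forall g h,
    `|Psi x (g^-1)%g - Psi x (h^-1)%g| <= L * X_dist K ip g h ;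
  (* the topology of the finite dimensional space Lie(K)^* is that of pointwise
     convergence *)
  KN_momentum_continuous : forall v, continuous (fun x => momentum Psi x v) }.

(* (K')^C, for a closed connected subgroup K' of K *)
Definition cplx (K' : set G) : set G :=
  [set g | exists k v, [/\ K' k, lie_algebra K' (v, 0) & g = (k * exp_i v)%g]].

(* Stability of x with respect to the restriction of Psi to (K')^C. In the
   second conjunct, Lie((K')^C_x) is a Lie algebra and Ad(h) is an automorphism,
   so it is enough to require that the image is contained in Lie(K'). *)
Definition stable (M : Type) (act : G -> M -> M) (Psi : M -> G -> R)
    (K' : set G) (x : M) : Prop :=
  (exists2 g, cplx K' g &
     forall v, lie_algebra K' (v, 0) -> momentum Psi (act g x) v = 0) /\
  (exists2 h, cplx K' h &
     Ad h @` lie_algebra (cplx K' `&` [set g | act g x = x])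
       `<=` lie_algebra K').

Definition compact_torus (T : set G) : Prop :=
  [/\ subgroup T, compact T, connected T
    & forall s t, T s -> T t -> (s * t = t * s)%g].

End LieTheory.

(* Main.v *)
Require Import Defs.
From HB Require Import structures.
From mathcomp Require Import all_boot all_order all_algebra.
From mathcomp Require Import all_classical all_reals all_analysis.

(** Write V for the real vectors v with exp (R v) in a subgroup K' of K, and K'^C
    for the set of all k exp (i v) with k in K' and v in V. The proof compares
    stability for K' with the growth of the convex functions

      t |-> Psi x (exp (i t v)),   t >= 0,   v in V nonzero.

    For every closed subgroup K' of K such that K'^C is a group, x is
    K'^C-stable if and only if all these functions are unbounded ([stableP]).
    This implies the theorem. A ray for a torus T in K is a ray for K, so that
    G-stability implies T^C-stability. Conversely every v is in the Lie algebra
    of a torus in K, the closure of exp (R v) ([line_torus]), and T^C-stability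
    for this torus gives the unboundedness along v.

    The criterion holds for the following reason. By compactness of the unit
    sphere, unboundedness along all rays means that v |-> Psi x (exp (i v)) has
    bounded sublevel sets on V ([ray_exhaustion], [exhaustiveP]). By the cocycle
    identity and the polar decomposition of G this does not change when x is
    replaced by g x with g in K'^C ([exhaustive_act]), so that one may look at a
    well chosen point of the orbit. If the momentum map vanishes at y = g x, each
    function has slope 0 at the origin; it is unbounded as soon as its second
    derivative there is nonzero, and vanishing of the second derivative puts a
    complex line in the Lie algebra of the stabilizer, which is impossible if
    this Lie algebra is conjugate to a subalgebra of k ([stable_unbounded]).
    Conversely a function with bounded sublevel sets has a minimum, at which the
    momentum map vanishes, and convexity forces the stabilizer of the minimum
    point to lie in K' ([unbounded_stable]).

    For a torus T, the set T^C is a group because real and imaginary exponentials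
    commute ([torus_cplxM]). This, and the conjugations in the definition of
    stability, need some Lie theory: exp (Ad g xi) = g exp (xi) g^-1 and the
    complex linearity of Ad g ([exp_Ad], [AdJ]). They follow from the fact that a
    one-parameter group is determined by its velocity ([one_parameter_exp]), and
    ultimately from the fact that maps with continuous directional derivatives
    are differentiable ([C1_differentiable]). *)

Set Implicit Arguments.
Unset Strict Implicit.
Unset Printing Implicit Defensive.

Import Order.TTheory GRing.Theory Num.Theory.
Import numFieldNormedType.Exports.
Local Open Scope classical_set_scope.
Local Open Scope ring_scope.

(** * Continuously differentiable maps *)

(** The differential is defined by a choice among the linear maps with the
    approximation property; an explicit candidate shows that one exists. *)
Lemma differentiable_of_linear (R : realType) (V W : normedModType R)
    (f : V -> W) (D : V -> W) (x : V) :
  linear D -> continuous D ->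
  (forall eps : R, 0 < eps ->
     \forall h \near 0, `|f (h + x) - f x - D h| <= eps * `|h|) ->
  differentiable f x.
Proof.
move=> linD cD HD.
pose DM := GRing.isLinear.Build _ _ _ _ _ linD.
pose DL : {linear V -> W} := HB.pack D DM.
apply/diffP => /=.
apply: (@getPex _ (fun (df : {linear V -> W}) => continuous df /\
  forall y, f y = f (lim (nbhs x)) + df (y - lim (nbhs x))
                  +o_(y \near x) (y - lim (nbhs x)))).
exists DL; split=> //; apply: eqaddoEx => z.
rewrite lim_id //.
have Hf : f = (fun y => f x + D (y - x)) +o_x (fun y => y - x).
  apply/eqaddoP => eps eps0;
    rewrite [\forall y \near _, _ <= _](near_shift 0) subr0.
  apply: filterS (HD eps eps0) => h.
  by rewrite /= !fctE /= addrK opprD addrA.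
by rewrite {1}Hf.
Qed.

(** The coordinates are bounded by the norm, so they are continuous; indexing
    by nat keeps the coordinates of a product and partial sums easy to write. *)
Record finite_coordinates (R : realType) (V : normedModType R) (N : nat)
    (b : nat -> V) (c : nat -> V -> R) : Prop := FiniteCoordinates {
  coord_linear : forall i (a : R) u v, c i (a *: u + v) = a * c i u + c i v ;
  coord_le_norm : forall i v, `|c i v| <= `|v| ;
  coord_sum : forall v, v = \sum_(i < N) c i v *: b i }.

Definition finite_dim {R : realType} (V : normedModType R) : Prop :=
  exists N b c, @finite_coordinates R V N b c.

Lemma finite_dim_rV (R : realType) n : finite_dim ('rV[R]_n : normedModType R).
Proof.
exists n, (fun i => \row_j (nat_of_ord j == i)%:R),
  (fun i (v : 'rV[R]_n) => oapp (v ord0) 0 (insub i)); split=> [i a u v|i v|v].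
- by case: insubP => [j _ _|_] /=; rewrite ?mxE// mulr0 addr0.
- case: insubP => [j _ _|_] /=; last by rewrite normr0.
  rewrite [leRHS]/Num.Def.normr /= mx_normrE.
  exact: (le_bigmax _ _ (ord0, j)).
- apply/rowP => j; rewrite summxE (bigD1 j) //= big1 ?addr0.
    by rewrite !mxE eqxx mulr1 valK.
  by move=> i ij; rewrite !mxE val_eqE eq_sym (negbTE ij) mulr0.
Qed.

Lemma finite_dim_prod (R : realType) (V W : normedModType R) :
  finite_dim V -> finite_dim W -> finite_dim ((V * W)%type : normedModType R).
Proof.
move=> [N [b [c [cl cn cs]]]] [N' [b' [c' [cl' cn' cs']]]].
exists (N + N')%N,
  (fun i => if (i < N)%N then (b i, 0) else (0, b' (i - N)%N)),
  (fun i p => if (i < N)%N then c i p.1 else c' (i - N)%N p.2).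
split=> [i a u v|i v|v].
- by case: ifP => _ /=; rewrite ?cl ?cl'.
- rewrite prod_normE; case: ifP => _.
    by rewrite (le_trans (cn _ _))// le_max lexx.
  by rewrite (le_trans (cn' _ _))// le_max lexx orbT.
- rewrite big_split_ord /=.
  under eq_bigr do rewrite ltn_ord.
  under [X in _ + X]eq_bigr do rewrite ltnNge leq_addr /= addKn.
  rewrite [LHS]surjective_pairing {1}(cs v.1) {1}(cs' v.2).
  pose f1 (i : 'I_N) := c i v.1 *: b i.
  pose f2 (i : 'I_N') := c' i v.2 *: b' i.
  have E1 : \sum_i (f1 i, 0 : W) = (\sum_i f1 i, 0).
    elim/big_ind2: _ => // x1 x2 y1 y2 -> ->.
    by apply: injective_projections; rewrite /= ?addr0.
  have E2 : \sum_i (0 : V, f2 i) = (0, \sum_i f2 i).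
    elim/big_ind2: _ => // x1 x2 y1 y2 -> ->.
    by apply: injective_projections; rewrite /= ?addr0.
  transitivity ((\sum_i f1 i, 0 : W) + (0 : V, \sum_i f2 i)).
    by apply: injective_projections; rewrite /= ?addr0 ?add0r.
  rewrite -E1 -E2; congr (_ + _); apply: eq_bigr => i _;
    by apply: injective_projections; rewrite /= ?scaler0.
Qed.

Lemma bounded_form_continuous (R : realType) (V : normedModType R) (c : V -> R) :
  (forall (a : R) u v, c (a *: u + v) = a * c u + c v) ->
  (forall v, `|c v| <= `|v|) -> continuous c.
Proof.
move=> cl cn x; apply/cvgrPdist_le => eps eps0; near=> y.
have -> : c x - c y = c (x - y).
  by rewrite [x - y]addrC -[- y]scaleN1r cl mulN1r addrC.
apply: le_trans (cn _) _; near: y; apply: cvgr_dist_le => //; exact: cvg_id.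
Unshelve. all: by end_near. Qed.

Lemma derive_linear_comp (R : realType) (V W : normedModType R) (c : W -> R)
    (f : V -> W) (x v : V) :
  (forall (a : R) u v, c (a *: u + v) = a * c u + c v) -> continuous c ->
  derivable f x v ->
  derivable (fun y => c (f y)) x v /\ 'D_v (fun y => c (f y)) x = c ('D_v f x).
Proof.
move=> cl cc dfx.
have c0 : c 0 = 0.
  have /eqP := cl 1 0 0; rewrite scale1r addr0 mul1r.
  by rewrite eq_sym -subr_eq0 addrK => /eqP.
have cN w : c (- w) = - c w.
  by have := cl (-1) w 0; rewrite addr0 scaleN1r mulN1r c0 addr0.
have cB a u w : c (a *: (u - w)) = a * (c u - c w).
  rewrite -[_ *: _]addr0 cl c0 addr0; congr (_ * _).
  by rewrite -[u]scale1r cl mul1r scale1r cN.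
have H : h^-1 *: (((fun y => c (f y)) \o shift x) (h *: v) - c (f x)) @[h --> 0^']
   --> c ('D_v f x).
  rewrite (_ : (fun h => _) =
    (fun h : R => c (h^-1 *: ((f \o shift x) (h *: v) - f x)))).
    exact: (cvg_comp _ _ dfx (cc _)).
  by apply/funext => h; rewrite cB.
by split; [apply/cvg_ex; exists (c ('D_v f x))|exact: cvg_lim].
Qed.

(** The interval is symmetric because the sign of a coordinate increment is not
    known. *)
Lemma mean_value_le (R : realType) (g : R -> R) (s d eps : R) :
  (forall r, `|r| <= `|s| -> derivable g r 1) ->
  (forall r, `|r| <= `|s| -> `|'D_1 g r - d| <= eps) ->
  `|g s - g 0 - s * d| <= eps * `|s|.
Proof.
move=> dg bg.
have [s0|s0] := leP 0 s.
- have s_le r : r \in `[0, s] -> `|r| <= `|s|.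
    by rewrite in_itv /= => /andP[r0 rs]; rewrite !ger0_norm.
  have [||c /s_le/bg cs ->] := @MVT_segment R g (fun r => 'D_1 g r) 0 s s0.
  + by move=> r /subset_itv_oo_cc/s_le/dg/derivableP.
  + by apply: derivable_within_continuous => r /s_le/dg.
  + by rewrite subr0 mulrC -mulrBr normrM mulrC ler_wpM2r.
- have s_le r : r \in `[s, 0] -> `|r| <= `|s|.
    by rewrite in_itv /= => /andP[sr r0]; rewrite !ler0_norm ?lerN2// ltW.
  have [||c /s_le/bg cs E] := @MVT_segment R g (fun r => 'D_1 g r) s 0 (ltW s0).
  + by move=> r /subset_itv_oo_cc/s_le/dg/derivableP.
  + by apply: derivable_within_continuous => r /s_le/dg.
  + have -> : g s - g 0 - s * d = s * ('D_1 g c - d).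
      by rewrite -[g s - g 0]opprB E sub0r mulrN opprK mulrBr mulrC.
    by rewrite normrM mulrC ler_wpM2r.
Qed.

Lemma derivable_line (R : realType) (V : normedModType R) (f : V -> R)
    (x v : V) (r : R) : derivable f (x + r *: v) v ->
  derivable (fun s : R => f (x + s *: v)) r 1 /\
  'D_1 (fun s : R => f (x + s *: v)) r = 'D_v f (x + r *: v).
Proof.
rewrite /derivable /derive => H.
suff -> : (fun h : R => h^-1 *: (((fun s => f (x + s *: v)) \o shift r) (h *: 1)
     - f (x + r *: v))) =
   (fun h => h^-1 *: ((f \o shift (x + r *: v)) (h *: v) - f (x + r *: v))) by [].
apply/funext => h /=; congr (_ *: (f _ - _)).
by rewrite [h%:A]mulr1 scalerDl addrCA.
Qed.

(** The increment of f is telescoped along the coordinate directions, and each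
    step is estimated by the mean value inequality, the directional derivatives
    being close to their values at x. *)
Lemma C1_differentiable_real (R : realType) (V : normedModType R)
    (U : set V) (f : V -> R) (x : V) :
  finite_dim V -> open U -> Ck 1 U f -> U x -> differentiable f x.
Proof.
move=> [N [b [c [cl cn cs]]]] oU [df cdf] Ux.
pose D h := \sum_(i < N) c i h * 'D_(b i) f x.
have cc i : continuous (c i) by exact: bounded_form_continuous.
apply: (@differentiable_of_linear _ _ _ _ D).
- move=> a u v; rewrite /D scaler_sumr -big_split; apply: eq_bigr => i _ /=.
  by rewrite cl mulrDl /GRing.scale /= mulrA.
- apply: continuous_big => [|i _ h]; first exact: add_continuous.
  by apply: cvgM; [exact: cc|exact: cvg_cst].
move=> eps eps0.
pose B := \sum_(i < N) `|b i|.
(* One unit more than N, so that the denominator is nonzero when N = 0. *)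
pose eps' := eps / N.+1%:R.
have eps'0 : 0 < eps' by rewrite divr_gt0.
have Hnear : \forall y \near x, forall i : 'I_N,
  U y /\ `|'D_(b i) f y - 'D_(b i) f x| <= eps'.
  apply: filter_forall => i; apply: filterI; first exact: open_nbhs_nbhs.
  have := cdf (b i) x Ux => /cvgrPdist_le /(_ _ eps'0); apply: filterS => y.
  by rewrite distrC.
have [del del0 Hdel] := (@nbhs_ballP _ _ _ _).1 Hnear.
near=> h.
(* B * |h| bounds the partial sums of h and also each step between them;
   + 1 makes the factor positive. *)
have hB : `|h| * (B + B + 1) < del.
  rewrite -ltr_pdivlMr; last by rewrite ltr_wpDl// addr_ge0// sumr_ge0.
  near: h; apply: nbhs0_lt.
  by rewrite divr_gt0// ltr_wpDl// addr_ge0// sumr_ge0.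
pose p (k : nat) := \sum_(i < N | (i < k)%N) c i h *: b i.
have step (k : 'I_N) : `|f (x + p k.+1) - f (x + p k) - c k h * 'D_(b k) f x|
    <= eps' * `|h|.
  have -> : p k.+1 = p k + c k h *: b k.
    rewrite /p (bigD1 k) //= addrC; congr (_ + _); apply: eq_bigl => i.
    by rewrite ltnS leq_eqVlt -val_eqE /=; case: ltngtP.
  have small r : `|r| <= `|c k h| -> ball x del (x + p k + r *: b k).
    move=> rc; rewrite -ball_normE /= -addrA opprD addNKr normrN.
    apply: le_lt_trans hB; rewrite mulrDr mulr1.
    have pB : `|p k| <= `|h| * B.
      rewrite /p big_mkcond /= (le_trans (ler_norm_sum _ _ _))// mulr_sumr.
      apply: ler_sum => i _; case: ifP => _; last by rewrite normr0 mulr_ge0.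
      by rewrite normrZ ler_wpM2r.
    have rB : `|r *: b k| <= `|h| * B.
      rewrite normrZ ler_pM// ?(le_trans rc)//.
      by rewrite /B (bigD1 k)//= lerDl sumr_ge0.
    rewrite (le_trans (ler_normD _ _))// mulrDr -[leLHS]addr0.
    by rewrite lerD// lerD.
  rewrite addrA.
  have := @mean_value_le R (fun s => f (x + p k + s *: b k)) (c k h)
    ('D_(b k) f x) eps'.
  rewrite scale0r addr0 => HH; apply: (le_trans (HH _ _)).
  + move=> r /small/Hdel /(_ k)[Ur _].
    exact: (derivable_line (df _ _ Ur)).1.
  + move=> r /small/Hdel /(_ k)[Ur]; rewrite (derivable_line (df _ _ Ur)).2 //.
  + by rewrite ler_pM2l.
have -> : f (h + x) - f x - D h =
   \sum_(k < N) (f (x + p k.+1) - f (x + p k) - c k h * 'D_(b k) f x).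
  rewrite sumrB; congr (_ - _).
  have := @telescope_sumr _ 0%N N (fun k => f (x + p k)) (leq0n _).
  rewrite big_mkord => ->; congr (f _ - f _).
    by rewrite addrC {1}(cs h); congr (_ + _); apply: eq_bigl => i; rewrite ltn_ord.
  by rewrite /p big1 ?addr0 // => i; rewrite ltn0.
apply: le_trans (ler_norm_sum _ _ _) _.
apply: (@le_trans _ _ (\sum_(k < N) eps' * `|h|)).
  by apply: ler_sum => k _; exact: step.
rewrite sumr_const card_ord -mulr_natl mulrA ler_wpM2r//.
by rewrite /eps' mulrCA ler_piMr ?ltW// ltr_pdivrMr// mul1r ltr_nat.
Unshelve. all: by end_near. Qed.

(** Iterated directional derivatives thus give true differentials, for which
    the chain rule holds; everything about charts below rests on this. *)
Lemma C1_differentiable (R : realType) (V W : normedModType R)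
    (U : set V) (f : V -> W) (x : V) :
  finite_dim V -> finite_dim W -> open U -> Ck 1 U f -> U x ->
  differentiable f x.
Proof.
move=> fV [N [b [c [cl cn cs]]]] oU [df cdf] Ux.
have cc i : continuous (c i) by exact: bounded_form_continuous.
have -> : f = \sum_(i < N) (fun y => c i (f y) *: b i).
  by apply/funext => y; rewrite fct_sumE -cs.
apply: differentiable_sum => i; apply: differentiableZl.
apply: C1_differentiable_real Ux => //; split=> [y v Uy|v y Uy] /=.
  exact: (derive_linear_comp (cl i) (cc i) (df y v Uy)).1.
have near_eq : {near y, (fun z => c i ('D_v f z)) =1 'D_v (fun z => c i (f z))}.
  apply: filterS (open_nbhs_nbhs (conj oU Uy)) => z Uz.
  by rewrite (derive_linear_comp (cl i) (cc i) (df z v Uz)).2.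
rewrite /prop_for /continuous_at /=
  (derive_linear_comp (cl i) (cc i) (df y v Uy)).2.
apply: cvg_trans (near_eq_cvg near_eq) _.
exact: (cvg_comp _ _ (cdf v y Uy) (cc i _)).
Qed.

Lemma finite_dim_Cvec (R : realType) n : finite_dim (Cvec R n).
Proof. by apply: finite_dim_prod; exact: finite_dim_rV. Qed.

(** Maps read in charts are meaningful only locally, so that differentials have to
    be compared through germs. *)
Lemma near_eq_differentiable (R : realType) (V W : normedModType R) (f g : V -> W)
  (x : V) :
  {near x, f =1 g} -> differentiable f x ->
  differentiable g x /\ forall v, 'd g x v = 'd f x v.
Proof.
move=> fg df.
have dg : differentiable g x.
  apply: (@differentiable_of_linear _ _ _ _ ('d f x)).
  - exact: linearP.
  - exact: diff_continuous.
  - move=> eps eps0.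
    have /eqaddoP/(_ eps eps0) H := diff_locally df.
    have fg' : \forall h \near 0, f (h + x) = g (h + x).
      by move: fg; rewrite [X in X -> _](near_shift 0) subr0.
    have fgx : f x = g x := nbhs_singleton fg.
    apply: filterS2 fg' H => h fgh.
    by rewrite !fctE /= -fgx -fgh opprD addrA.
split; first exact: dg.
move=> v; rewrite -(deriveE v dg) -(deriveE v df).
by apply/esym/(@near_eq_derive _ _ _ f g x v).
Qed.

Lemma chain_rule_near (R : realType) (V W Z : normedModType R) (f : V -> W)
    (g : W -> Z) (h : V -> Z) (x : V) :
  differentiable f x -> differentiable g (f x) ->
  (\forall z \near x, g (f z) = h z) ->
  differentiable h x /\ forall v, 'd h x v = 'd g (f x) ('d f x v).
Proof.
move=> df dg fgh; have dgf := differentiable_comp df dg.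
have [dh E] := @near_eq_differentiable R V Z (g \o f) h x fgh dgf.
by split=> // v; rewrite E (diff_comp df dg).
Qed.

Lemma chain_rule_near_pair (R : realType) (V W W' Z : normedModType R) (f : V -> W)
    (f' : V -> W') (g : W * W' -> Z) (h : V -> Z) (x : V) :
  differentiable f x -> differentiable f' x -> differentiable g (f x, f' x) ->
  (\forall z \near x, g (f z, f' z) = h z) ->
  differentiable h x /\
  forall v, 'd h x v = 'd g (f x, f' x) ('d f x v, 'd f' x v).
Proof.
move=> df df' dg gh; have dff := differentiable_pair df df'.
have [dh E] := @chain_rule_near R V _ Z (fun z => (f z, f' z)) g h x dff dg gh.
by split=> // v; rewrite E (diff_pair df df').
Qed.

Lemma diff_comp_at (R : realType) (V W Z : normedModType R) (f : V -> W)
    (g : W -> Z) (x v : V) :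
  differentiable f x -> differentiable g (f x) ->
  'd (fun z => g (f z)) x v = 'd g (f x) ('d f x v).
Proof. by move=> df dg; rewrite -[LHS]/('d (g \o f) x v) diff_comp. Qed.

(** * Convex functions on a line and along rays *)

Section ConvexFunction.
Variables (R : realType) (f f1 : R -> R).
Hypotheses (df : forall t : R, is_derive t 1 f (f1 t))
  (df1 : forall t : R, derivable f1 t 1) (f2 : forall t : R, 0 <= derive1 f1 t).

Let f1E (t : R) : derive1 f t = f1 t.
Proof. by rewrite derive1E; apply: derive_val. Qed.

Let cont_in (g : R -> R) (dg : forall t : R, derivable g t 1) (a b : R) :
  {within `[a, b], continuous g}.
Proof. by apply: derivable_within_continuous => t _. Qed.

Let cont_f (a b : R) : {within `[a, b], continuous f}.
Proof. by apply: cont_in => t; exact: ex_derive. Qed.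

Lemma convex_slope_le (s t : R) : s <= t -> f1 s <= f1 t.
Proof.
move=> st; exact: (@ger0_derive1_ndecr _ f1 s t (fun x _ => @df1 x)
  (fun x _ => f2 x) (@cont_in f1 (@df1) s t) s t (lexx _) st (lexx _)).
Qed.

(** Either the slope at s is nonpositive and f decreases up to s, or it is
    positive and f increases after s. *)
Lemma convex_le_max (s t : R) : 0 <= s -> s <= t -> f s <= Num.max (f 0) (f t).
Proof.
move=> s0 st; rewrite le_max; have [fs|fs] := leP (f1 s) 0.
  apply/orP; left; apply: (@ler0_derive1_nincr _ f 0 s _ _ (@cont_f 0 s)) => //.
  move=> r; rewrite in_itv /= f1E => /andP[_ /ltW rs].
  exact: le_trans (convex_slope_le rs) fs.
apply/orP; right; apply: (@ger0_derive1_ndecr _ f s t _ _ (@cont_f s t)) => //.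
move=> r; rewrite in_itv /= f1E => /andP[/ltW sr _].
exact: le_trans (ltW fs) (convex_slope_le sr).
Qed.

(** The derivative equals the right derivative, which sees only constant values. *)
Lemma derive1_right_cst (g : R -> R) (a d : R) : 0 < d -> derivable g a 1 ->
  (forall t : R, a <= t -> t < a + d -> g t = g a) -> derive1 g a = 0.
Proof.
move=> d0 dg gc; rewrite derive1E /derive cvg_at_rightE //.
apply: lim_near_cst => //; near=> h.
rewrite /= [h%:A]mulr1 gc ?subrr ?scaler0 //.
  by rewrite lerDr; apply: ltW; near: h; exact: nbhs_right_gt.
by rewrite addrC ltrD2l; near: h; exact: nbhs_right_lt.
Unshelve. all: by end_near. Qed.

(** A one-sided neighbourhood is enough to compute both derivatives at 0. *)
Lemma convex_flat (d : R) : 0 < d ->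
  (forall t : R, 0 <= t -> t <= d -> f t = f 0) ->
  derive1 f1 0 = 0.
Proof.
move=> d0 fc.
have f'c (t : R) : 0 <= t -> t < d -> f1 t = 0.
  move=> t0 td; rewrite -f1E.
  apply: (@derive1_right_cst f _ (d - t)); first by rewrite subr_gt0.
    exact: ex_derive.
  move=> r tr; rewrite addrC subrK => rd.
  by rewrite (fc r (le_trans t0 tr) (ltW rd)) (fc t t0 (ltW td)).
apply: (@derive1_right_cst f1 _ d) => // t t0; rewrite add0r => td.
by rewrite !f'c.
Qed.

(** The slope is nondecreasing and is not constantly 0 near 0, so it becomes
    positive, and from then on f grows at least linearly. *)
Lemma convex_unbounded : f1 0 = 0 -> derive1 f1 0 != 0 ->
  forall c, exists2 t : R, 0 <= t & c < f t.
Proof.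
move=> f0 f20 c.
have [t1 t10 ft1] : exists2 t1 : R, 0 < t1 & 0 < f1 t1.
  apply: contrapT => H; move/eqP: f20; apply.
  apply: (@derive1_right_cst f1 _ 1) => // t t0 _; rewrite f0.
  apply/eqP; rewrite eq_le -{2}f0 convex_slope_le // andbT.
  rewrite leNgt; apply/negP => ft; apply: H; exists t => //.
  by rewrite lt_def t0 andbT; apply: contraTneq ft => ->; rewrite f0 ltxx.
(* where the affine minorant of slope f1 t1 at t1 exceeds c *)
pose t := t1 + `|c - f t1 + 1| / f1 t1.
have t1t : t1 <= t by rewrite lerDl divr_ge0 // ltW.
exists t; first exact: le_trans (ltW t10) t1t.
have [r rt E] := @MVT_segment _ f f1 t1 t t1t (fun x _ => @df x) (@cont_f t1 t).
rewrite -(ltrD2r (- f t1)) E.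
have rt1 : t1 <= r by move: rt; rewrite in_itv => /andP[].
apply: (@lt_le_trans _ _ (f1 t1 * (t - t1))); last first.
  by rewrite ler_wpM2r ?subr_ge0 // convex_slope_le.
rewrite /t addrAC subrr add0r mulrC divfK ?gt_eqF //.
by apply: lt_le_trans (ler_norm _); rewrite ltrDl.
Qed.
End ConvexFunction.

(** By compactness of the unit sphere of V, one radius works for all rays:
    exceeding c at some point of a ray is an open condition on its direction,
    and by the quasiconvexity it persists further along the ray. *)
Lemma ray_exhaustion (R : realType) (n : nat) (phi : 'rV[R]_n -> R)
    (V : set 'rV[R]_n) :
  continuous phi -> closed V -> (forall t v, V v -> V (t *: v)) ->
  (forall v (s t : R), 0 <= s -> s <= t ->
     phi (s *: v) <= Num.max (phi 0) (phi (t *: v))) ->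
  (forall v, V v -> v != 0 -> forall c, exists2 t : R, 0 <= t & c < phi (t *: v)) ->
  forall c, exists B, forall v, V v -> phi v <= c -> `|v| <= B.
Proof.
move=> cphi cV coneV star unb c.
pose S := [set v | V v /\ `|v| = 1].
have cS : compact S.
  apply: bounded_closed_compact.
    by exists 1; split=> // M M1 v [_ v1] /=; rewrite v1; exact: ltW.
  apply: closedI => //.
  apply: (@closed_comp _ _ (fun v : 'rV[R]_n => `|v|) [set 1]) => [v _|].
    exact: norm_continuous.
  exact: closed_eq.
pose c' := Num.max (phi 0) c.
have := (compact_near_coveringP _).1 cS R (pinfty_nbhs R)
   (fun m u => V u -> c' < phi (m *: u)).
have H : forall x : 'rV_n, S x ->
   \forall x' \near x & i \near +oo, V x' -> c' < phi (i *: x').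
  move=> u [Vu u1].
  have u0 : u != 0 by rewrite -normr_eq0 u1 oner_eq0.
  have [t t0 ct] := unb u Vu u0 c'.
  have N1 : \forall u' \near u, c' < phi (t *: u').
    have : {for u, continuous (fun u' : 'rV[R]_n => phi (t *: u'))}.
      by apply: continuous_comp; [exact: scaler_continuous|exact: cphi].
    by move/cvgr_gt; apply.
  have N2 : \forall i \near +oo, t <= i by apply: nbhs_pinfty_ge; exact: num_real.
  exists ([set u' : 'rV[R]_n | c' < phi (t *: u')], [set i | t <= i]) => //.
  move=> [u' i] [/= Hu ti] _.
  have := lt_le_trans Hu (star u' t i t0 ti); rewrite lt_max => /orP[|//].
  by rewrite /c' gt_max ltxx.
move=> /(_ _ H) [B [_ HB]].
exists (Num.max B 0 + 1) => v Vv; apply: contraTT; rewrite -!ltNge => Bv.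
have v0 : 0 < `|v| by apply: le_lt_trans Bv; rewrite addr_ge0 // le_max lexx orbT.
have vB : B < `|v|.
  apply: le_lt_trans Bv; apply: (@le_trans _ _ (Num.max B 0)); rewrite ?lerDl//.
  by rewrite le_max lexx.
have Vu : V (`|v|^-1 *: v) by exact: coneV.
have := HB _ vB _ (conj Vu _) Vu.
rewrite scalerA divff ?gt_eqF // scale1r normrZ normfV normr_id mulVf ?gt_eqF //.
move=> /(_ erefl); apply: le_lt_trans; by rewrite le_max lexx orbT.
Qed.

(** * Differentiable maps into a complex Lie group *)

Lemma open_preimage_on (S T : topologicalType) (f : S -> T) (U : set S)
  (V : set T) :
  open U -> open V -> (forall x, U x -> {for x, continuous f}) ->
  open [set x | U x /\ V (f x)].
Proof.
move=> oU oV cf; rewrite openE => x [Ux Vfx]; rewrite /interior.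
apply: filterI; first exact: open_nbhs_nbhs.
by apply: cf => //; exact: open_nbhs_nbhs.
Qed.

Lemma continuous_pair (T U W : topologicalType) (f : T -> U) (g : T -> W) (p : T) :
  {for p, continuous f} -> {for p, continuous g} ->
  {for p, continuous (fun z => (f z, g z))}.
Proof.
move=> cf cg; have cp : (f z, g z) @[z --> p] -->
  nbhs (f p, g p) by exact: cvg_pair.
exact: cp.
Qed.

Local Opaque diff derive.

Section GroupValuedMaps.
Variables (R : realType) (n : nat) (G : topologicalGroupType).
Variables (A : set (chart R n G)) (e : Cvec R n -> G).
Hypotheses (hG : complex_Lie_group A) (he : exponential A e).

Lemma continuous_mulg (T : topologicalType) (g1 g2 : T -> G) (p : T) :
  {for p, continuous g1} -> {for p, continuous g2} ->
  {for p, continuous (fun z => (g1 z * g2 z)%g)}.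
Proof.
move=> c1 c2; have cm : continuous (fun q : G * G => (q.1 * q.2)%g) :=
  mulg_continuous.
have cp : (g1 z, g2 z) @[z --> p] --> nbhs (g1 p, g2 p) by exact: cvg_pair.
exact: (cvg_comp _ _ cp (cm _)).
Qed.

(** Continuity has to be required: composites with charts see nothing of g at the
    points which it sends outside the domain of the chart. *)
Definition gdiff (V : normedModType R) (g : V -> G) (p : V) : Prop :=
  {for p, continuous g} /\
  forall b, A b -> cdom b (g p) -> differentiable (fun z => cmap b (g z)) p.

Lemma gdiff_cst (V : normedModType R) (h : G) (p : V) : gdiff (fun=> h) p.
Proof. by split=> [|b Ab bh]; [exact: cvg_cst|exact: differentiable_cst]. Qed.

Lemma gdiff_comp (V W : normedModType R) (f : V -> W) (g : W -> G) (p : V) :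
  differentiable f p -> gdiff g (f p) -> gdiff (fun z => g (f z)) p.
Proof.
move=> df [cg dg]; split=> [|b Ab bg].
  by apply: continuous_comp cg; exact: differentiable_continuous.
exact: (differentiable_comp df (dg b Ab bg)).
Qed.

Lemma gdiff_exp z : gdiff e z.
Proof.
split=> [|b Ab bz]; first exact: exp_continuous he z.
have [/(_ 1%N) C1 _] := exp_holomorphic he Ab.
apply: C1_differentiable C1 bz; try exact: finite_dim_Cvec.
by apply: open_comp (cdom_open b) => ? _; exact: exp_continuous he _.
Qed.

Lemma gdiff_chart_inv a u : A a -> cimg a u -> gdiff (cinv a) u.
Proof.
move=> Aa au; split=> [|b Ab bu]; first exact: cinv_continuous.
have [/(_ 1%N) C1 _] := clg_compat hG Aa Ab.
apply: C1_differentiable C1 (conj au bu); try exact: finite_dim_Cvec.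
apply: open_preimage_on (cdom_open b) _; first exact: cimg_open.
by move=> v av; exact: cinv_continuous.
Qed.

Definition mul_chart (a b c : chart R n G) (p : Cvec R n * Cvec R n) : Cvec R n :=
  cmap c (cinv a p.1 * cinv b p.2)%g.

Lemma mul_chart_open (a b c : chart R n G) :
  open [set p : Cvec R n * Cvec R n | [/\ cimg a p.1, cimg b p.2
                 & cdom c (cinv a p.1 * cinv b p.2)%g]].
Proof.
rewrite openE => -[u v] [/= au bv cuv]; rewrite /interior.
have N1 : \forall p \near (u, v), cimg a p.1.
  by apply: cvg_fst; apply: open_nbhs_nbhs; split=> //; exact: cimg_open.
have N2 : \forall p \near (u, v), cimg b p.2.
  by apply: cvg_snd; apply: open_nbhs_nbhs; split=> //; exact: cimg_open.
have N3 : \forall p \near (u, v), cdom c (cinv a p.1 * cinv b p.2)%g.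
  have : {for (u, v), continuous (fun p => (cinv a p.1 * cinv b p.2)%g)}.
    apply: continuous_mulg.
      apply: (@continuous_comp _ _ _ (fun p : Cvec R n * Cvec R n => p.1) (cinv a)).
        exact: cvg_fst.
      exact: cinv_continuous au.
    apply: (@continuous_comp _ _ _ (fun p : Cvec R n * Cvec R n => p.2) (cinv b)).
      exact: cvg_snd.
    exact: cinv_continuous bv.
  by apply; apply: open_nbhs_nbhs; split=> //; exact: cdom_open.
by apply: filterS3 N1 N2 N3 => p.
Qed.

Lemma mul_chart_holomorphic (a b c : chart R n G) (p : Cvec R n * Cvec R n) :
  A a -> A b -> A c -> cimg a p.1 -> cimg b p.2 ->
  cdom c (cinv a p.1 * cinv b p.2)%g ->
  differentiable (mul_chart a b c) p /\
  forall q, 'd (mul_chart a b c) p (Jc2 q) = Jc ('d (mul_chart a b c) p q).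
Proof.
move=> Aa Ab Ac ap bp cp.
have [/(_ 1%N) C1 hol] := clg_mul hG Aa Ab Ac.
have dm : differentiable (mul_chart a b c) p.
  apply: C1_differentiable C1 _ => //; last exact: mul_chart_open.
    by apply: finite_dim_prod; exact: finite_dim_Cvec.
  exact: finite_dim_Cvec.
by split=> // q; rewrite -!deriveE//; apply: hol.
Qed.

Section product.
Variables (V : normedModType R) (g1 g2 : V -> G) (p : V).
Hypotheses (d1 : gdiff g1 p) (d2 : gdiff g2 p).

(** The chain rule, through the multiplication read in charts. It reduces every
    differential of a product to those of the factors. *)
Lemma diff_mulg a1 a2 b : A a1 -> A a2 -> A b -> cdom a1 (g1 p) ->
  cdom a2 (g2 p) -> cdom b (g1 p * g2 p)%g ->
  differentiable (fun z => cmap b (g1 z * g2 z)%g) p /\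
  forall v, 'd (fun z => cmap b (g1 z * g2 z)%g) p v =
    'd (mul_chart a1 a2 b) (cmap a1 (g1 p), cmap a2 (g2 p))
     ('d (fun z => cmap a1 (g1 z)) p v, 'd (fun z => cmap a2 (g2 z)) p v).
Proof.
move=> Aa1 Aa2 Ab a1p a2p bp.
have [i1 k1] := cmapP a1p; have [i2 k2] := cmapP a2p.
have hm : cdom b (cinv a1 (cmap a1 (g1 p)) * cinv a2 (cmap a2 (g2 p)))%g.
  by rewrite k1 k2.
have [dm _] := @mul_chart_holomorphic a1 a2 b (_, _) Aa1 Aa2 Ab i1 i2 hm.
have D1 := d1.2 _ Aa1 a1p; have D2 := d2.2 _ Aa2 a2p.
apply: (chain_rule_near_pair D1 D2 dm).
have N1 : \forall z \near p, cdom a1 (g1 z).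
  by apply: d1.1; apply: open_nbhs_nbhs; split => //; exact: cdom_open.
have N2 : \forall z \near p, cdom a2 (g2 z).
  by apply: d2.1; apply: open_nbhs_nbhs; split => //; exact: cdom_open.
apply: filterS2 N1 N2 => z z1 z2 /=.
by rewrite /mul_chart /= (cmapP z1).2 (cmapP z2).2.
Qed.

Lemma gdiffM : gdiff (fun z => (g1 z * g2 z)%g) p.
Proof.
split=> [|b Ab bp].
  by apply: continuous_mulg; [exact: d1.1|exact: d2.1].
have [a1 Aa1 ap1] := clg_cover hG (g1 p).
have [a2 Aa2 ap2] := clg_cover hG (g2 p).
exact: (diff_mulg Aa1 Aa2 Ab ap1 ap2 bp).1.
Qed.
End product.

(** Statements about velocities at 1 are independent of the chart by this
    formula. *)
Lemma chart_change (V : normedModType R) (g : V -> G) (p v : V) a b :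
  gdiff g p -> A a -> A b -> cdom a (g p) -> cdom b (g p) ->
  'd (fun z => cmap b (g z)) p v =
  'd (fun u => cmap b (cinv a u)) (cmap a (g p)) ('d (fun z => cmap a (g z)) p v).
Proof.
move=> dg Aa Ab ap bp.
have [ia ka] := cmapP ap.
have dt := (gdiff_chart_inv Aa ia).2 b Ab; rewrite ka in dt.
have dga := dg.2 a Aa ap.
apply: (@chain_rule_near R V _ _ (fun z => cmap a (g z))
  (fun u => cmap b (cinv a u))
  _ _ dga (dt bp) _).2.
have N1 : \forall z \near p, cdom a (g z).
  by apply: dg.1; apply: open_nbhs_nbhs; split => //; exact: cdom_open.
by apply: filterS N1 => z z1 /=; rewrite (cmapP z1).2.
Qed.

Lemma exp0 : e 0 = 1%g.
Proof.
have := exp_add he 0 0 0; rewrite addr0 !scale0r =>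
  /(congr1 (fun x => (e 0)^-1 * x)%g).
by rewrite mulKg mulVg.
Qed.

Lemma exp_lineD s t xi : e ((s + t) *: xi) = (e (s *: xi)%R * e (t *: xi)%R)%g.
Proof. exact: exp_add he s t xi. Qed.

Lemma expN xi : e (- xi) = (e xi)^-1%g.
Proof.
have := exp_lineD (-1) 1 xi; rewrite addNr scale0r scaleN1r scale1r exp0.
by move=> /(congr1 (fun x => x * (e xi)^-1)%g); rewrite mulgK mul1g => <-.
Qed.

(** The identification of Lie(G) with the tangent space at 1 given by the
    differential of e at 0, read in the chart a. *)
Definition dexp0 (a : chart R n G) (xi : Cvec R n) : Cvec R n :=
  'D_xi (fun z => cmap a (e z)) 0.

Section dexp0.
Variables (a : chart R n G) (Aa : A a) (a1 : cdom a 1%g).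

Lemma dexp0E xi : dexp0 a xi = 'd (fun z => cmap a (e z)) 0 xi.
Proof.
by rewrite /dexp0 deriveE //; apply: (gdiff_exp 0).2 => //; rewrite exp0.
Qed.

Lemma dexp0D xi eta : dexp0 a (xi + eta) = dexp0 a xi + dexp0 a eta.
Proof. by rewrite !dexp0E linearD. Qed.

Lemma dexp0Z t xi : dexp0 a (t *: xi) = t *: dexp0 a xi.
Proof. by rewrite !dexp0E linearZ. Qed.

Lemma dexp0J xi : dexp0 a (Jc xi) = Jc (dexp0 a xi).
Proof. by apply: (exp_holomorphic he Aa).2; rewrite /= exp0. Qed.

Lemma dexp0_inj : injective (dexp0 a).
Proof. exact: bij_inj (exp_diff0 he Aa a1). Qed.
End dexp0.

(** The derivative of g at p in the direction v is the tangent vector xi at 1;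
    meaningful when g p = 1. For a curve and v = 1 this is the velocity at time p. *)
Definition tangent (V : normedModType R) (g : V -> G) (p v : V) (xi : Cvec R n) :=
  forall a, A a -> cdom a 1%g -> 'd (fun z => cmap a (g z)) p v = dexp0 a xi.

Lemma tangent_exists (V : normedModType R) (g : V -> G) (p v : V) :
  gdiff g p -> g p = 1%g -> exists xi, tangent g p v xi.
Proof.
move=> dg gp; have [a Aa a1] := clg_cover hG 1%g.
have [f fK Kf] := exp_diff0 he Aa a1.
exists (f ('d (fun z => cmap a (g z)) p v)) => b Ab b1.
set xi := f _.
have gpa : cdom a (g p) by rewrite gp.
have gpb : cdom b (g p) by rewrite gp.
have e0a : cdom a (e 0) by rewrite exp0.
have e0b : cdom b (e 0) by rewrite exp0.
have E1 := @chart_change V g p v a b dg Aa Ab gpa gpb.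
have E2 := @chart_change _ e 0 xi a b (gdiff_exp 0) Aa Ab e0a e0b.
rewrite gp in E1; rewrite exp0 in E2.
have E3 : 'd (fun z => cmap a (e z)) 0 xi = 'd (fun z => cmap a (g z)) p v.
  by rewrite -(dexp0E Aa a1); exact: Kf.
apply: etrans E1 _; apply: esym; apply: etrans (dexp0E Ab b1 xi) _.
apply: etrans E2 _; apply: f_equal; exact: E3.
Qed.

Lemma tangent_unique (V : normedModType R) (g : V -> G) (p v : V) xi eta :
  tangent g p v xi -> tangent g p v eta -> xi = eta.
Proof.
have [a Aa a1] := clg_cover hG 1%g.
move=> vxi veta; apply: (dexp0_inj Aa a1).
exact: etrans (esym (vxi a Aa a1)) (veta a Aa a1).
Qed.

(** The differential of the multiplication at (1, 1) is the addition: the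
    restrictions to the two factors are the identity, as 1 is neutral. *)
Lemma mul_chart_diff_at1 a p q : A a -> cdom a 1%g ->
  'd (mul_chart a a a) (cmap a 1%g, cmap a 1%g) (p, q) = p + q.
Proof.
move=> Aa a1; have [i1 k1] := cmapP a1.
have dcinv : gdiff (cinv a) (cmap a 1%g) by exact: gdiff_chart_inv.
have dcst : gdiff (fun _ : Cvec R n => 1%g : G) (cmap a 1%g) by exact: gdiff_cst.
have id_near : {near cmap a 1%g, id =1 (fun z => cmap a (cinv a z))}.
  apply: filterS (open_nbhs_nbhs (conj (@cimg_open _ _ _ a) i1)) => z az.
  by rewrite (cinvP az).2.
have dcinvE v : 'd (fun z => cmap a (cinv a z)) (cmap a 1%g) v = v.
  have [|_ ->] := near_eq_differentiable id_near; first by [].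
  by rewrite diff_val.
have dcst1 v : 'd (fun z : Cvec R n => cmap a (1%g : G)) (cmap a 1%g) v = 0.
  by rewrite diff_cst.
have hm : cdom a (cinv a (cmap a 1%g) * cinv a (cmap a 1%g))%g.
  by rewrite k1 mulg1.
have [dm _] := @mul_chart_holomorphic a a a (_, _) Aa Aa Aa i1 i1 hm.
have c1 : cdom a (cinv a (cmap a 1%g)) by rewrite k1.
have cl : cdom a (cinv a (cmap a 1%g) * 1)%g by rewrite k1 mulg1.
have cr : cdom a (1 * cinv a (cmap a 1%g))%g by rewrite k1 mulg1.
(* the left factor varies in the chart, the right one is constantly 1 *)
have E1 : 'd (mul_chart a a a) (cmap a 1%g, cmap a 1%g) (p, 0) = p.
  have [_ /(_ p) E] := diff_mulg dcinv dcst Aa Aa Aa c1 a1 cl.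
  have E' : 'd (fun z => cmap a (cinv a z * 1)%g) (cmap a 1%g) p = p.
    by under eq_fun do rewrite mulg1.
  apply: etrans (etrans (esym E) E').
  by apply: f_equal2; [rewrite k1|apply: f_equal2;
    [exact/esym/dcinvE|exact/esym/dcst1]].
have E2 : 'd (mul_chart a a a) (cmap a 1%g, cmap a 1%g) (0, q) = q.
  have [_ /(_ q) E] := diff_mulg dcst dcinv Aa Aa Aa a1 c1 cr.
  have E' : 'd (fun z => cmap a (1 * cinv a z)%g) (cmap a 1%g) q = q.
    by under eq_fun do rewrite mul1g.
  apply: etrans (etrans (esym E) E').
  by apply: f_equal2; [rewrite k1|apply: f_equal2;
    [exact/esym/dcst1|exact/esym/dcinvE]].
apply: etrans (f_equal2 +%R E1 E2).
apply: etrans (linearD _ _ _); apply: f_equal.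
by apply: injective_projections; rewrite /= ?addr0 ?add0r.
Qed.

Lemma tangentM (V : normedModType R) (g1 g2 : V -> G) (p v : V) xi eta :
  gdiff g1 p -> gdiff g2 p -> g1 p = 1%g -> g2 p = 1%g ->
  tangent g1 p v xi -> tangent g2 p v eta ->
  tangent (fun z => (g1 z * g2 z)%g) p v (xi + eta).
Proof.
move=> d1 d2 p1 p2 v1 v2 a Aa a1.
have c1 : cdom a (g1 p) by rewrite p1.
have c2 : cdom a (g2 p) by rewrite p2.
have c12 : cdom a (g1 p * g2 p)%g by rewrite p1 p2 mulg1.
have [_ /(_ v) E] := diff_mulg d1 d2 Aa Aa Aa c1 c2 c12.
rewrite p1 p2 in E; apply: (etrans E).
rewrite dexp0D //; apply: etrans (mul_chart_diff_at1 _ _ Aa a1).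
by apply: f_equal; exact: (f_equal2 pair (v1 a Aa a1) (v2 a Aa a1)).
Qed.

(** The derivative of g at p in the direction w is i times the one in the
    direction v. Products preserve this, since the multiplication is holomorphic;
    it is how complex linearity of the adjoint action is obtained. *)
Definition J_related (V : normedModType R) (g : V -> G) (p v w : V) :=
  forall a, A a -> cdom a (g p) ->
  'd (fun z => cmap a (g z)) p w = Jc ('d (fun z => cmap a (g z)) p v).

Lemma J_related_cst (V : normedModType R) (h : G) (p v w : V)
  : J_related (fun=> h) p v w.
Proof.
move=> a Aa ah; rewrite diff_cst.
by apply: injective_projections; rewrite /= ?oppr0.
Qed.

Lemma J_relatedM (V : normedModType R) (g1 g2 : V -> G) (p v w : V) :
  gdiff g1 p -> gdiff g2 p -> J_related g1 p v w -> J_related g2 p v w ->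
  J_related (fun z => (g1 z * g2 z)%g) p v w.
Proof.
move=> d1 d2 J1 J2 b Ab bp.
have [a1 Aa1 ap1] := clg_cover hG (g1 p).
have [a2 Aa2 ap2] := clg_cover hG (g2 p).
have [_ E] := diff_mulg d1 d2 Aa1 Aa2 Ab ap1 ap2 bp.
apply: (etrans (E w)); apply: etrans (f_equal _ (esym (E v))).
have [i1 k1] := cmapP ap1; have [i2 k2] := cmapP ap2.
have hm : cdom b (cinv a1 (cmap a1 (g1 p)) * cinv a2 (cmap a2 (g2 p)))%g.
  by rewrite k1 k2.
have [_ Jm] := @mul_chart_holomorphic a1 a2 b (_, _) Aa1 Aa2 Ab i1 i2 hm.
apply: etrans (Jm _); apply: f_equal.
exact: (f_equal2 pair (J1 a1 Aa1 ap1) (J2 a2 Aa2 ap2)).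
Qed.

Lemma J_related_exp p v : J_related e p v (Jc v).
Proof.
move=> a Aa ap; have da := (gdiff_exp p).2 a Aa ap.
by rewrite -!deriveE //; apply: (exp_holomorphic he Aa).2.
Qed.

Lemma tangent_J (V : normedModType R) (g : V -> G) (p v w : V) xi :
  g p = 1%g -> tangent g p v xi -> J_related g p v w -> tangent g p w (Jc xi).
Proof.
move=> gp vg Jg a Aa a1; have gpa : cdom a (g p) by rewrite gp.
by apply: etrans (Jg a Aa gpa) _; rewrite dexp0J //; apply: f_equal; exact: vg.
Qed.

End GroupValuedMaps.

(** * One-parameter subgroups and the adjoint action *)

Section OneParameter.
Variables (R : realType) (n : nat) (G : topologicalGroupType).
Variables (A : set (chart R n G)) (e : Cvec R n -> G).
Hypotheses (hG : complex_Lie_group A) (he : exponential A e).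

Local Notation gdiff := (gdiff A).
Local Notation tangent := (tangent A e).
Local Notation J_related := (J_related A).

Definition critical (V : normedModType R) (g : V -> G) (p v : V) :=
  forall a, A a -> cdom a (g p) -> 'd (fun z => cmap a (g z)) p v = 0.

Lemma critical_cst (V : normedModType R) (h : G) (p v : V) :
  critical (fun=> h) p v.
Proof. by move=> a Aa ah; rewrite diff_cst. Qed.

Lemma criticalM (V : normedModType R) (g1 g2 : V -> G) (p v : V) :
  gdiff g1 p -> gdiff g2 p -> critical g1 p v -> critical g2 p v ->
  critical (fun z => (g1 z * g2 z)%g) p v.
Proof.
move=> d1 d2 z1 z2 b Ab bp.
have [a1 Aa1 ap1] := clg_cover hG (g1 p).
have [a2 Aa2 ap2] := clg_cover hG (g2 p).
have [_ /(_ v) E] := diff_mulg hG d1 d2 Aa1 Aa2 Ab ap1 ap2 bp.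
apply: (etrans E); apply: etrans (linear0 _); apply: f_equal.
exact: (f_equal2 pair (z1 _ Aa1 ap1) (z2 _ Aa2 ap2)).
Qed.

Lemma critical_velocity0 (V : normedModType R) (g : V -> G) (p v : V) :
  g p = 1%g -> tangent g p v 0 -> critical g p v.
Proof.
move=> gp vg a Aa; rewrite gp => a1; apply: etrans (vg a Aa a1) _.
by rewrite (dexp0E he Aa a1) linear0.
Qed.

(** The set of t with d t = d 0 is closed, and it is open because d is constant
    in a chart by the mean value inequality; the line is connected. *)
Lemma critical_constant (d : R -> G) : (forall t, gdiff d t) ->
  (forall t, critical d t 1) -> forall t, d t = d 0.
Proof.
move=> dd d0.
pose E := [set t | d t = d 0].
have cR : connected [set: R] by apply/connected_intervalP.
suff EE : E = setT by move=> t; suff : E t by []; rewrite EE.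
apply: cR; first by exists 0.
  exists E; last by rewrite setTI.
  rewrite openE => t Et; rewrite /interior.
  have [a Aa at_] := clg_cover hG (d t).
  have N1 : \forall s \near t, cdom a (d s).
    by apply: (dd t).1; apply: open_nbhs_nbhs; split => //; exact: cdom_open.
  have [del del0 Hdel] := (@nbhs_ballP _ _ _ _).1 N1.
  apply/nbhs_ballP; exists del => // s ts.
  rewrite /E /= -Et -(cmapP at_).2 -(cmapP (Hdel s ts)).2; congr (cinv a _).
  have [N [b [c [cl cn cs]]]] := finite_dim_Cvec R n.
  rewrite (cs (cmap a (d s))) (cs (cmap a (d t))); apply: eq_bigr => i _;
    congr (_ *: _).
  pose g r := c i (cmap a (d (t + r *: 1))).
  have der r : `|r| <= `|s - t| -> derivable g r 1 /\ 'D_1 g r = 0.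
    move=> rs.
    have tr : cdom a (d (t + r *: 1)).
      apply: Hdel; rewrite -ball_normE /= [r%:A]mulr1 opprD addNKr normrN.
      by apply: le_lt_trans rs _; rewrite distrC; move: ts; rewrite -ball_normE.
    have D := (dd (t + r *: 1)).2 a Aa tr.
    have D' : derivable (fun z => cmap a (d z)) (t + r *: 1) 1.
      exact: diff_derivable.
    have [D1 E1] := derive_linear_comp (cl i)
      (bounded_form_continuous (cl i) (cn i))
      D'.
    have [D2 E2] := @derivable_line R R _ t 1 r D1.
    split=> //; apply: etrans E2 _; apply: etrans E1 _.
    rewrite deriveE // (d0 _ a Aa tr).
    by have /eqP := cl i 1 0 0;
      rewrite scaler0 addr0 mul1r eq_sym -subr_eq0 addrK => /eqP.
  have := @mean_value_le R g (s - t) 0 0.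
  rewrite mulr0 subr0 mul0r normr_le0 subr_eq0 => H.
  have {H} /eqP : g (s - t) == g 0.
    apply: H => r /der[] // _ ->; by rewrite subr0 normr0.
  by rewrite /g scale0r addr0 [(s - t)%:A]mulr1 addrC subrK.
exists E; last by rewrite setTI.
have -> : E = d @^-1` [set d 0] by [].
apply: closed_comp => [t _|]; first exact: (dd t).1.
exact/accessible_closed_set1/hausdorff_accessible/(clg_hausdorff hG).
Qed.

Lemma gdiff_exp_line (xi : Cvec R n) (t : R) : gdiff (fun s : R => e (s *: xi)) t.
Proof.
apply: (@gdiff_comp R n G A _ _ (fun s : R => s *: xi) e t); last exact: gdiff_exp.
exact: ex_diff.
Qed.

Lemma tangent_line (g : Cvec R n -> G) (xi eta : Cvec R n) : gdiff g 0 ->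
  g 0 = 1%g ->
  tangent g 0 xi eta -> tangent (fun s : R => g (s *: xi)) 0 1 eta.
Proof.
move=> dg g0 vg a Aa a1.
have ga : cdom a (g 0) by rewrite g0.
have dl : differentiable (fun s : R => s *: xi) (0 : R) by exact: ex_diff.
have D := dg.2 a Aa ga; rewrite -(scale0r xi) in D.
have E := @diff_comp_at R R _ _ _ _ _ 1 dl D.
apply: etrans E _; apply: etrans (vg a Aa a1).
have dlE : 'd (fun s : R => s *: xi) (0 : R) (1 : R) = xi.
  by rewrite diff_val scale1r.
by rewrite dlE; apply: f_equal2; first by rewrite scale0r.
Qed.

Lemma tangent_exp xi : tangent e 0 xi xi.
Proof. by move=> a Aa a1; rewrite (dexp0E he Aa a1). Qed.

(** If c is a one-parameter group with the velocity of e (t *: eta), the curve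
    h t = c t * e (- t *: eta) has zero derivative everywhere, because
    h (t + s) = c t * h s * e (- t *: eta) and h has zero velocity at 0. So h is
    constant. *)
Lemma one_parameter_exp (c : R -> G) (eta : Cvec R n) :
  (forall s t, c (s + t) = (c s * c t)%g) -> gdiff c 0 -> tangent c 0 1 eta ->
  forall t, c t = e (t *: eta).
Proof.
move=> cD dc0 vc.
have c0 : c 0 = 1%g.
  have := cD 0 0; rewrite addr0 => /(congr1 (fun x => (c 0)^-1 * x)%g).
  by rewrite mulKg mulVg.
have dsub (t : R) : differentiable (fun z : R => z - t) t by exact: ex_diff.
have dcs t : gdiff (fun z => c (z - t)) t.
  by apply: (@gdiff_comp _ _ _ _ _ _ (fun z => z - t) c) => //; rewrite subrr.
have dc t : gdiff c t.
  rewrite (_ : c = fun z => (c t * c (z - t))%g).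
    by apply: gdiffM => //; exact: gdiff_cst.
  by apply/funext => z; rewrite -cD addrC subrK.
pose h s := (c s * e (s *: - eta)%R)%g.
have dh t : gdiff h t by apply: gdiffM => //; exact: gdiff_exp_line.
have h0 : h 0 = 1%g by rewrite /h c0 scale0r (exp0 he) mulg1.
have vh : tangent h 0 1 0.
  have le0 : e (0 *: - eta) = 1%g by rewrite scale0r (exp0 he).
  have vl : tangent (fun s : R => e (s *: - eta)) 0 1 (- eta).
    by apply: tangent_line; [exact: gdiff_exp|exact: exp0 he|exact: tangent_exp].
  have := tangentM hG he dc0 (gdiff_exp_line (- eta) 0) c0 le0 vc vl.
  by rewrite subrr.
have hc t : h t = h 0.
  apply: critical_constant => // {}t.
  have hE : h = fun z => (c t * h (z - t) * e (t *: - eta)%R)%g.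
    apply/funext => z; rewrite /h !mulgA -cD [t + _]addrC subrK -mulgA.
    by rewrite -(exp_lineD he) subrK.
  have dhs : gdiff (fun z => h (z - t)) t.
    by apply: (@gdiff_comp _ _ _ _ _ _ (fun z => z - t) h).
  rewrite hE; apply: criticalM.
  - by apply: gdiffM => //; exact: gdiff_cst.
  - exact: gdiff_cst.
  - apply: criticalM => //; [exact: gdiff_cst|exact: critical_cst|].
    move=> a Aa /=; rewrite subrr h0 => a1.
    have ha : cdom a (h 0) by rewrite h0.
    have D := (dh 0).2 a Aa ha; rewrite -(subrr t) in D.
    have E := @diff_comp_at R R _ _ _ _ _ 1 (dsub t) D.
    apply: etrans E _.
    have cr := critical_velocity0 h0 vh Aa ha.
    have dsubE : 'd (fun z : R => z - t) t (1 : R) = 1 by rewrite diff_val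
      !fctE subr0.
    by apply: etrans cr; rewrite dsubE; apply: f_equal2; first by rewrite subrr.
  - exact: critical_cst.
move=> t; move: (hc t); rewrite h0 /h scalerN (expN he) =>
  /(congr1 (fun x => x * e (t *: eta)%R)%g).
by rewrite mulgVK mul1g.
Qed.

(** The map whose derivative at 0 is Ad g. *)
Definition conj_exp (g : G) (z : Cvec R n) : G := (g * e z * g^-1)%g.

Lemma conj_exp0 g : conj_exp g 0 = 1%g.
Proof. by rewrite /conj_exp (exp0 he) mulg1 mulgV. Qed.

Lemma gdiff_conj_exp g z : gdiff (conj_exp g) z.
Proof.
apply: gdiffM => //; last exact: gdiff_cst.
by apply: gdiffM => //; [exact: gdiff_cst|exact: gdiff_exp].
Qed.

Lemma gdiff_conj_exp_line g xi t : gdiff (fun s : R => conj_exp g (s *: xi)) t.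
Proof.
apply: (@gdiff_comp R n G A _ _ (fun s : R => s *: xi) (conj_exp g) t);
  last exact: gdiff_conj_exp.
exact: ex_diff.
Qed.

Lemma has_velocityP (c : R -> G) xi : gdiff c 0 -> c 0 = 1%g ->
  has_velocity A e c xi <-> tangent c 0 1 xi.
Proof.
move=> dc c0; split=> H a Aa a1; have ca : cdom a (c 0) by rewrite c0.
  by have [D E] := H a Aa a1; rewrite -deriveE; [exact: E|exact: dc.2 a Aa ca].
have D := dc.2 a Aa ca; split; first exact: diff_derivable.
by rewrite deriveE //; exact: H.
Qed.

(** Ad g xi is defined by a choice which defaults to 0; the curve does have a
    velocity, hence the default is never taken. *)
Lemma tangent_Ad g xi : tangent (conj_exp g) 0 xi (Ad A e g xi).
Proof.
have [eta veta] := tangent_exists hG he xi (gdiff_conj_exp g 0) (conj_exp0 g).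
suff -> : Ad A e g xi = eta by [].
have vl := tangent_line (gdiff_conj_exp g 0) (conj_exp0 g) veta.
have cl0 : conj_exp g ((0 : R) *: xi) = 1%g by rewrite scale0r conj_exp0.
have hvP := has_velocityP _ (gdiff_conj_exp_line g xi 0) cl0.
have hx : has_velocity A e (fun t : R => conj_exp g (t *: xi)) (Ad A e g xi).
  apply: (@xgetPex _ 0 (has_velocity A e (fun t : R => conj_exp g (t *: xi)))).
  by exists eta; apply/hvP.
exact: (tangent_unique hG he ((hvP _).1 hx) vl).
Qed.

(** Both sides extend to one-parameter groups with the same velocity. *)
Lemma exp_Ad g xi : e (Ad A e g xi) = (g * e xi * g^-1)%g.
Proof.
have conj_expD s t : conj_exp g ((s + t) *: xi) =
  (conj_exp g (s *: xi)%R * conj_exp g (t *: xi)%R)%g.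
  by rewrite /conj_exp (exp_lineD he) !mulgA mulgVK.
have := one_parameter_exp conj_expD (gdiff_conj_exp_line g xi 0)
  (tangent_line (gdiff_conj_exp g 0) (conj_exp0 g) (tangent_Ad g xi)) 1.
by rewrite !scale1r => <-.
Qed.

Lemma AdZ g t xi : Ad A e g (t *: xi) = t *: Ad A e g xi.
Proof.
apply: (tangent_unique hG he (tangent_Ad g _)) => a Aa a1.
rewrite (dexp0Z he Aa a1); apply: etrans (linearZ _ _) _.
by apply: f_equal; exact: tangent_Ad g xi a Aa a1.
Qed.

(** Conjugation by g is holomorphic. *)
Lemma AdJ g xi : Ad A e g (Jc xi) = Jc (Ad A e g xi).
Proof.
apply: (tangent_unique hG he (tangent_Ad g _)).
apply: (tangent_J he (conj_exp0 g) (tangent_Ad g xi)).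
apply: J_relatedM => //; [|exact: gdiff_cst| |exact: J_related_cst].
- by apply: gdiffM => //; [exact: gdiff_cst|exact: gdiff_exp].
- apply: J_relatedM => //; [exact: gdiff_cst|exact: gdiff_exp|exact:
    J_related_cst|].
  exact: J_related_exp.
Qed.

(** The product of commuting one-parameter groups is one, and its velocity is
    the sum of the velocities. *)
Lemma exp_add_commute xi eta :
  (forall s t : R, (e (s *: xi)%R * e (t *: eta)%R = e (t *: eta)%R * e
    (s *: xi)%R)%g) ->
  e (xi + eta) = (e xi * e eta)%g.
Proof.
move=> com.
pose c (t : R) := (e (t *: xi)%R * e (t *: eta)%R)%g.
have cD s t : c (s + t) = (c s * c t)%g.
  by rewrite /c !(exp_lineD he) !mulgA; congr (_ * _)%g; rewrite -!mulgA com.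
have lx z : e ((0 : R) *: z) = 1%g by rewrite scale0r (exp0 he).
have lv z : tangent (fun s : R => e (s *: z)) 0 1 z.
  by apply: tangent_line; [exact: gdiff_exp|exact: exp0 he|exact: tangent_exp].
have vc := tangentM hG he (gdiff_exp_line xi 0) (gdiff_exp_line eta 0) (lx xi)
  (lx eta)
   (lv xi) (lv eta).
have dc := gdiffM hG (gdiff_exp_line xi 0) (gdiff_exp_line eta 0).
by have := one_parameter_exp cD dc vc 1; rewrite /c !scale1r => ->.
Qed.

End OneParameter.

Section ImaginaryDirections.
Variables (R : realType) (n : nat) (G : topologicalGroupType).
Variables (A : set (chart R n G)) (e : Cvec R n -> G).
Hypotheses (hG : complex_Lie_group A) (he : exponential A e).

Implicit Types (g h : G) (u v w : 'rV[R]_n) (s t : R).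

Lemma exp_line_inj (xi eta : Cvec R n) :
  (forall t : R, e (t *: xi) = e (t *: eta)) -> xi = eta.
Proof.
move=> E; have fE : (fun t : R => e (t *: xi)) = (fun t : R => e (t *: eta)).
  by apply/funext.
have v1 z : tangent A e (fun s : R => e (s *: z)) 0 1 z.
  by apply: tangent_line; [exact: gdiff_exp|exact: exp0 he|exact: tangent_exp].
by have := v1 xi; rewrite fE => v2; exact: (tangent_unique hG he v2 (v1 eta)).
Qed.

(** If g commutes with exp (R xi) then Ad g fixes xi, hence J xi by complex
    linearity. So commutation passes to the imaginary directions. *)
Lemma commute_J g (xi : Cvec R n) :
  (forall t : R, (g * e (t *: xi)%R = e (t *: xi)%R * g)%g) ->
  forall t : R, (g * e (t *: Jc xi)%R = e (t *: Jc xi)%R * g)%g.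
Proof.
move=> com t.
have AdE : Ad A e g xi = xi.
  apply: exp_line_inj => s.
  by rewrite -(AdZ hG he) (exp_Ad hG he) com mulgK.
have := exp_Ad hG he g (t *: Jc xi).
by rewrite (AdZ hG he) (AdJ hG he) AdE => E; rewrite {2}E mulgVK.
Qed.

Lemma exp_iZ t v : exp_i e (t *: v) = e (t *: ((0, v) : Cvec R n)).
Proof.
by rewrite /exp_i; congr e; apply: injective_projections => //=; rewrite scaler0.
Qed.

Lemma exp_i0 : exp_i e 0 = 1%g.
Proof. exact: exp0 he. Qed.

Lemma exp_iDl s t v : exp_i e ((s + t) *: v) =
  (exp_i e (s *: v) * exp_i e (t *: v))%g.
Proof. by rewrite !exp_iZ (exp_lineD he). Qed.

Lemma exp_iN v : exp_i e (- v) = (exp_i e v)^-1%g.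
Proof.
rewrite /exp_i -(expN he); congr e.
by apply: injective_projections; rewrite /= ?oppr0.
Qed.

Lemma exp_i_continuous : continuous (exp_i e).
Proof.
move=> v; apply: (@continuous_comp _ _ _ (fun v : 'rV[R]_n => (0, v) : Cvec R n) e).
  by apply: (@continuous_pair _ _ _ (fun=> 0) id);
    [exact: cst_continuous|exact: cvg_id].
exact: exp_continuous he _.
Qed.

End ImaginaryDirections.

(** * Smooth functions along one-parameter subgroups *)

Section SmoothLine.
Variables (R : realType) (n : nat) (G : topologicalGroupType).
Variables (A : set (chart R n G)) (e : Cvec R n -> G).
Hypotheses (hG : complex_Lie_group A) (he : exponential A e).

Lemma smooth_fun_continuous (F : G -> R) : smooth_fun A F -> continuous F.
Proof.
move=> sF g; have [a Aa ag] := clg_cover hG g.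
have near_eq : {near g, (fun h => F (cinv a (cmap a h))) =1 F}.
  apply: filterS (open_nbhs_nbhs (conj (@cdom_open _ _ _ a) ag)) => h ah.
  by rewrite (cmapP ah).2.
have [ig kg] := cmapP ag.
have : {for g, continuous (fun h => F (cinv a (cmap a h)))}.
  apply: (@continuous_comp _ _ _ (cmap a) (fun u => F (cinv a u))).
    exact: cmap_continuous.
  exact: sF a Aa 0%N _ ig.
rewrite /prop_for /continuous_at /= kg; apply: cvg_trans.
exact: near_eq_cvg near_eq.
Qed.

(** In a chart, f' is a finite sum of products of a coordinate of the velocity
    of t |-> e (t *: xi) by a partial derivative of F; both factors are of
    class C^1, so f' is differentiable in turn. *)
Lemma smooth_on_line (F : G -> R) (xi : Cvec R n) : smooth_fun A F ->
  let f := fun t : R => F (e (t *: xi)) in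
  exists f1 : R -> R, forall t : R, is_derive t 1 f (f1 t) /\ derivable f1 t 1.
Proof.
move=> sF f; exists (derive1 f : R -> R) => t0.
suff [D1 D2] : derivable f t0 1 /\ derivable (derive1 f : R -> R) t0 1.
  split; last exact: D2.
  by split; [exact: D1|rewrite derive1E].
have [a Aa at0] := clg_cover hG (e (t0 *: xi)).
pose Fa u := F (cinv a u); pose Ea z := cmap a (e z).
pose U := e @^-1` cdom a.
have oU : open U.
  by apply: open_comp (@cdom_open _ _ _ a) => ? _; exact: exp_continuous he _.
have EC2 : Ck 2 U Ea := (exp_holomorphic he Aa).1 2%N.
have FC2 : Ck 2 (cimg a) Fa := sF a Aa 2%N.
have fV := finite_dim_Cvec R n.
have [N [b [c [cl cn cs]]]] := fV.
have cc i : continuous (c i) by exact: bounded_form_continuous.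
have dline (t : R) : differentiable (fun s : R => s *: xi) t by exact: ex_diff.
have dE z : U z -> differentiable Ea z.
  move=> Uz; apply: C1_differentiable Uz => //;
    exact: (exp_holomorphic he Aa).1 1%N.
have dF u : cimg a u -> differentiable Fa u.
  by move=> au; apply: C1_differentiable_real au => //;
    [exact: cimg_open|exact: sF a Aa 1%N].
have nU : \forall t \near t0, U (t *: xi).
  have := differentiable_continuous (dline t0); apply.
  exact: open_nbhs_nbhs.
have UE z : U z -> cimg a (Ea z) by move=> /cmapP[].
pose p i (t : R) := c i ('D_xi Ea (t *: xi)).
pose q i (t : R) := 'D_(b i) Fa (Ea (t *: xi)).
have dfE t : U (t *: xi) -> derivable f t 1 /\ derive1 f t = \sum_(i < N) p i t
  * q i t.
  move=> Ut.
  have dEt := dE _ Ut; have dFt := dF _ (UE _ Ut).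
  have dEl : differentiable (fun s : R => Ea (s *: xi)) t.
    exact: (differentiable_comp (dline t) dEt).
  have dlE : 'd (fun s : R => s *: xi) t (1 : R) = xi.
    by rewrite diff_val scale1r.
  have ne : \forall s \near t, Fa (Ea (s *: xi)) = f s.
    have : \forall s \near t, U (s *: xi).
      have := differentiable_continuous (dline t); apply.
      exact: open_nbhs_nbhs.
    by apply: filterS => s Us; rewrite /Fa /Ea /f (cmapP Us).2.
  have [D E] := @chain_rule_near R R _ _ (fun s : R => Ea (s *: xi)) Fa f t
    dEl dFt ne.
  split; first exact: diff_derivable.
  rewrite derive1E deriveE // E.
  rewrite (@diff_comp_at R R _ _ (fun s : R => s *: xi) Ea t 1 (dline t) dEt) dlE.
  rewrite -(deriveE xi dEt) {1}(cs ('D_xi Ea (t *: xi))) linear_sum.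
  by apply: eq_bigr => i _; rewrite linearZ /= /q (deriveE _ dFt).
split; first exact: (dfE t0 at0).1.
have ne : \forall t \near t0, \sum_(i < N) p i t * q i t = (derive1 f) t.
  by apply: filterS nU => t Ut; rewrite (dfE t Ut).2.
apply: (near_eq_derivable ne).
have -> : (fun t => \sum_(i < N) p i t * q i t) = \sum_(i < N) (p i \* q i).
  by apply/funext => t; rewrite fct_sumE.
apply: derivable_sum => i; apply: derivableM.
  have DE : differentiable (fun z => 'D_xi Ea z) (t0 *: xi).
    by apply: (@C1_differentiable _ _ _ U) => //; exact: EC2.2 xi.
  have DEl : derivable (fun t : R => 'D_xi Ea (t *: xi)) t0 1.
    by apply: diff_derivable; exact: (differentiable_comp (dline t0) DE).
  exact: (derive_linear_comp (cl i) (cc i) DEl).1.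
apply: diff_derivable.
have DF : differentiable (fun u => 'D_(b i) Fa u) (Ea (t0 *: xi)).
  apply: (@C1_differentiable_real _ _ (cimg a)) => //.
  - exact: cimg_open.
  - exact: FC2.2 (b i).
  - exact: UE.
have dEl : differentiable (fun s : R => Ea (s *: xi)) t0.
  exact: (differentiable_comp (dline t0) (dE _ at0)).
exact: (differentiable_comp dEl DF).
Qed.

End SmoothLine.

(** * Complexified tori *)

Section Tori.
Variables (R : realType) (n : nat) (G : topologicalGroupType).
Variables (A : set (chart R n G)) (e : Cvec R n -> G).
Variable K : set G.
Hypotheses (hG : complex_Lie_group A) (he : exponential A e).

Implicit Types (g h : G) (u v w : 'rV[R]_n) (s t : R).

Section torus.
Variable T : set G.
Hypotheses (sgT : subgroup T) (abT : forall g h, T g -> T h -> (g * h = h * g)%g).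
Let V : set 'rV[R]_n := [set v | lie_algebra e T (v, 0)].

Let JrE v : (0, v) = Jc ((v, 0) : Cvec R n).
Proof. by rewrite /Jc /= oppr0. Qed.

Lemma torus_commute_exp_i k v t : T k -> V v ->
  (k * exp_i e (t *: v) = exp_i e (t *: v) * k)%g.
Proof.
move=> Tk Vv; rewrite exp_iZ JrE; apply: (commute_J hG he) => s.
by apply: abT => //; exact: Vv.
Qed.

(** Elements of a torus commute, hence so do the imaginary exponentials of its
    Lie algebra, by two applications of the complex linearity of Ad. *)
Lemma torus_exp_i_commute u v s t : V u -> V v ->
  (exp_i e (s *: u) * exp_i e (t *: v) = exp_i e (t *: v) * exp_i e (s *: u))%g.
Proof.
move=> Vu Vv; rewrite [exp_i e (t *: v)]exp_iZ JrE; apply: (commute_J hG he) => r.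
by rewrite torus_commute_exp_i //; exact: Vv.
Qed.

Lemma torus_exp_iD u v : V u -> V v ->
  exp_i e (u + v) = (exp_i e u * exp_i e v)%g.
Proof.
move=> Vu Vv; rewrite /exp_i -(exp_add_commute hG he) => [|s t].
  by congr e; apply: injective_projections; rewrite /= ?addr0.
by rewrite -!exp_iZ torus_exp_i_commute.
Qed.

Lemma torus_imagD u v : V u -> V v -> V (u + v).
Proof.
move=> Vu Vv t; have [_ TM _] := sgT.
have -> : t *: ((u + v, 0) : Cvec R n) = t *: ((u, 0) : Cvec R n) + t
  *: ((v, 0) : Cvec R n).
  by apply: injective_projections; rewrite /= ?scalerDr ?scaler0 ?addr0.
rewrite (exp_add_commute hG he); first by apply: TM; [exact: Vu|exact: Vv].
by move=> r s; rewrite !scalerA; apply: abT; [exact: Vu|exact: Vv].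
Qed.

Lemma torus_imagN v : V v -> V (- v).
Proof.
move=> Vv t; have := Vv (- t); congr (T (e _)).
by apply: injective_projections; rewrite /= ?scalerN ?scaleNr ?scaler0 ?oppr0.
Qed.

(** The polar form of the elements of the complexified torus is multiplicative
    because all the factors commute. *)
Lemma torus_cplxM g h : cplx e T g -> cplx e T h -> cplx e T (g * h)%g.
Proof.
move=> [k [u [Tk Vu ->]]] [l [v [Tl Vv ->]]]; exists (k * l)%g, (u + v).
have [_ TM _] := sgT; split; [exact: TM|exact: torus_imagD|].
rewrite torus_exp_iD // !mulgA; congr (_ * _)%g; rewrite -!mulgA; congr (_ * _)%g.
by have := torus_commute_exp_i 1 Tl Vu; rewrite scale1r.
Qed.

Lemma torus_cplxV g : cplx e T g -> cplx e T (g^-1)%g.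
Proof.
move=> [k [u [Tk Vu ->]]]; exists (k^-1)%g, (- u).
have [_ _ TV] := sgT; split; [exact: TV|exact: torus_imagN|].
have := torus_commute_exp_i (-1) (TV _ Tk) Vu; rewrite scaleN1r (exp_iN he).
by move=> ->; rewrite invgM.
Qed.
End torus.

Section closure.
Variable S : set G.
Hypotheses (sgS : subgroup S) (abS : forall g h, S g -> S h -> (g * h = h * g)%g).

Let closure_min (C : set G) : closed C -> S `<=` C -> closure S `<=` C.
Proof. by move=> cC SC; apply: subset_trans (closureS SC) cC. Qed.

Let mulr_cont h : continuous (fun g => (g * h)%g).
Proof. by move=> g; apply: continuous_mulg;
  [exact: cvg_id|exact: cst_continuous]. Qed.

Let mull_cont h : continuous (fun g => (h * g)%g).
Proof. by move=> g; apply: continuous_mulg;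
  [exact: cst_continuous|exact: cvg_id]. Qed.

Let inv_cont : continuous (fun g : G => (g^-1)%g).
Proof. exact: invg_continuous. Qed.

Let closed_pre (f : G -> G) (C : set G) : continuous f -> closed C ->
  closed (f @^-1` C).
Proof. by move=> cf cC; apply: closed_comp => // g _; exact: cf. Qed.

Lemma closure_subgroup : subgroup (closure S).
Proof.
have [S1 SM SV] := sgS; have SC := @subset_closure _ S.
have cS := @closed_closure _ S.
split.
- exact: SC.
- have step g h : S g -> closure S h -> closure S (g * h)%g.
    move=> Sg; apply: (closure_min (closed_pre (@mull_cont g) cS)) => k Sk.
    by apply: SC; exact: SM.
  move=> g h + Sh; apply: (closure_min (closed_pre (@mulr_cont h) cS)) => k Sk.
  exact: step.
- move=> g; apply: (closure_min (closed_pre inv_cont cS)) => k Sk.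
  by apply: SC; exact: SV.
Qed.

(** In a Hausdorff group commutation is a closed condition, the commutator being
    equal to 1; it is passed to the closure one factor at a time. *)
Lemma closure_commute g h : closure S g -> closure S h -> (g * h = h * g)%g.
Proof.
have closed1 : closed [set 1%g : G].
  exact/accessible_closed_set1/hausdorff_accessible/(clg_hausdorff hG).
have comE (k l : G) : (k * l * k^-1 * l^-1 = 1)%g <-> (k * l = l * k)%g.
  split=> [E|->]; last by rewrite mulgK mulgV.
  have := congr1 (fun z => z * l * k)%g E; by rewrite mul1g !mulgVK.
have step (k l : G) : S k -> closure S l -> (k * l = l * k)%g.
  move=> Sk Sl; apply/comE; move: l Sl.
  pose F (l : G) : G := (k * l * k^-1 * l^-1)%g.
  apply: (@closure_min (F @^-1` [set 1%g])).
    apply: closed_pre closed1 => l.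
    apply: (@continuous_mulg _ _ (fun l => (k * l * k^-1)%g) (fun l => l^-1%g)).
      apply: (@continuous_mulg _ _ (fun l => (k * l)%g));
        last exact: cst_continuous.
      exact: mull_cont.
    exact: inv_cont.
  by move=> l Sl /=; apply/comE; exact: abS.
move=> + Sh; move=> Sg; apply/comE; move: g Sg.
pose F (g : G) : G := (g * h * g^-1 * h^-1)%g.
apply: (@closure_min (F @^-1` [set 1%g])).
  apply: closed_pre closed1 => g.
  apply: (@continuous_mulg _ _ (fun g => (g * h * g^-1)%g));
    last exact: cst_continuous.
  apply: (@continuous_mulg _ _ (fun g => (g * h)%g) (fun g => g^-1%g)).
    exact: mulr_cont.
  exact: inv_cont.
by move=> g Sg /=; apply/comE; exact: step.
Qed.
End closure.

(** The closure of a one-parameter subgroup of K is a torus: closure preserves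
    the group laws, commutativity, and connectedness. *)
Lemma line_torus (hK : complexification e K) v : exists T : set G,
  [/\ compact_torus T, T `<=` K & lie_algebra e T (v, 0)].
Proof.
pose S := range (fun t : R => e (t *: ((v, 0) : Cvec R n))).
have clK : closed K := compact_closed (clg_hausdorff hG) (cplx_compact hK).
have SK : S `<=` K.
  by move=> _ [t _ <-]; have := (cplx_lie hK (v, 0)).2 erefl; apply.
have sgS : subgroup S.
  split.
  - by exists 0 => //; rewrite scale0r (exp0 he).
  - by move=> _ _ [s _ <-] [t _ <-]; exists (s + t) => //; rewrite (exp_lineD he).
  - by move=> _ [s _ <-]; exists (- s) => //; rewrite scaleNr (expN he).
have abS g h : S g -> S h -> (g * h = h * g)%g.
  by move=> [a _ <-] [b _ <-]; rewrite -!(exp_lineD he) addrC.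
have clSK : closure S `<=` K := subset_trans (closureS SK) clK.
exists (closure S); split=> //.
- split.
  + exact: closure_subgroup.
  + exact: subclosed_compact (@closed_closure _ _) (cplx_compact hK) clSK.
  + apply: connected_closure; apply: connected_continuous_connected.
      by apply/connected_intervalP.
    apply: continuous_subspaceT => t; exact: (gdiff_exp_line he _ t).1.
  + by move=> s t; exact: closure_commute.
- by move=> t; apply: subset_closure; exists t.
Qed.

End Tori.

(** * Stability in terms of rays *)

Section KempfNess.
Variables (R : realType) (n : nat) (G : topologicalGroupType).
Variables (A : set (chart R n G)) (e : Cvec R n -> G) (K : set G).
Variables (ip : 'rV[R]_n -> 'rV[R]_n -> R).
Variables (M : topologicalType) (act : G -> M -> M) (Psi : M -> G -> R).
Hypotheses (hG : complex_Lie_group A) (he : exponential A e)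
  (hact : group_action act) (hPsi : Kempf_Ness A e act K ip Psi).

Implicit Types (x y : M) (g h : G) (u v w : 'rV[R]_n) (s t : R).

Let exp_i_cont : continuous (exp_i e) := exp_i_continuous he.

Lemma PsiM x g h : Psi x (h * g)%g = Psi x g + Psi (act g x) h.
Proof. by rewrite (KN_cocycle hPsi). Qed.

Lemma Psi1 x : Psi x 1%g = 0.
Proof.
have := PsiM x 1%g 1%g; rewrite mulg1 (act1 hact) => /eqP.
by rewrite -subr_eq0 opprD addNKr oppr_eq0 => /eqP.
Qed.

(** The convexity hypotheses speak of derivatives as values of limits, which are
    meaningful only where the limits exist; smoothness of Psi x ensures this. *)
Lemma Psi_line x v : let f := fun t : R => Psi x (exp_i e (t *: v)) in
  exists f1 : R -> R, [/\ forall t : R, is_derive t 1 f (f1 t),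
    forall t : R, derivable f1 t 1, forall t : R, 0 <= derive1 f1 t,
    f1 0 = momentum e Psi x v &
    derive1 f1 0 = 0 <-> (forall a b : R, act (e (a *: v, b *: v)) x = x)].
Proof.
move=> f.
have [f1 Hf1] := smooth_on_line hG he ((0, v) : Cvec R n) (KN_smooth hPsi x).
have fE : (fun t : R => Psi x (e (t *: ((0, v) : Cvec R n)))) = f.
  by apply/funext => t; rewrite /f exp_iZ.
rewrite fE in Hf1.
have f1E : f1 = derive1 f.
  by apply/funext => t; rewrite derive1E; apply/esym; have [D _] := Hf1 t;
    exact: derive_val.
exists f1; split.
- by move=> t; exact: (Hf1 t).1.
- by move=> t; exact: (Hf1 t).2.
- by move=> t; rewrite f1E; exact: (KN_convex hPsi x v t).
- by rewrite f1E.
- by rewrite f1E; exact: (KN_degenerate hPsi x v).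
Qed.

Section restriction.
Variables (kappa : G -> G) (rho : G -> 'rV[R]_n).
Hypotheses (rho_cont : continuous rho)
  (polar : forall g, K (kappa g) /\ g = (kappa g * exp_i e (rho g))%g)
  (polar_unique : forall k v, K k ->
      kappa (k * exp_i e v)%g = k /\ rho (k * exp_i e v)%g = v).
Hypothesis hK : complexification e K.
Variable K' : set G.
Let V : set 'rV[R]_n := [set v | lie_algebra e K' (v, 0)].
Let H := cplx e K'.
Hypotheses (sK'K : K' `<=` K) (sgK' : subgroup K') (clK' : closed K')
  (HM : forall g h, H g -> H h -> H (g * h)%g)
  (HV : forall g, H g -> H (g^-1)%g).

Let K1 : K 1%g. Proof. by case: (cplx_subgroup hK). Qed.
Let KM g h : K g -> K h -> K (g * h)%g.
Proof. by case: (cplx_subgroup hK) => _ KM _; exact: KM. Qed.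

Lemma rho_exp_i v : rho (exp_i e v) = v.
Proof. by have [_] := polar_unique v K1; rewrite mul1g. Qed.

Lemma rho_mulK k g : K k -> rho (k * g)%g = rho g.
Proof.
move=> Kk; have [Kg {1}->] := polar g; rewrite mulgA.
by have [_ ->] := polar_unique (rho g) (KM Kk Kg).
Qed.

(** Left K-invariance: only the imaginary part of the polar decomposition
    matters. *)
Lemma Psi_rho x g : Psi x g = Psi x (exp_i e (rho g)).
Proof. by have [Kg {1}->] := polar g; rewrite (KN_invariant hPsi). Qed.

Lemma Psi_exp_i_continuous x : continuous (fun v => Psi x (exp_i e v)).
Proof.
move=> v; apply: continuous_comp; first exact: exp_i_cont.
exact: (smooth_fun_continuous hG (KN_smooth hPsi x)).
Qed.

Lemma imag0 : V 0.
Proof. by move=> t; have [K1' _ _] := sgK'; rewrite scaler0 (exp0 he). Qed.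

Lemma imagZ t v : V v -> V (t *: v).
Proof.
move=> Vv s; have := Vv (s * t); rewrite -scalerA; congr (K' (e (_ *: _))).
by apply: injective_projections => //=; rewrite scaler0.
Qed.

Lemma imag_closed : closed V.
Proof.
have -> : V = \bigcap_(t in [set: R])
    (fun v : 'rV[R]_n => e (t *: ((v, 0) : Cvec R n))) @^-1` K'.
  by apply/seteqP; split=> v Vv => [t _|t]; exact: Vv.
apply: closed_bigI => t _; apply: closed_comp => // v _.
apply: (@continuous_comp _ _ _ (fun v : 'rV[R]_n => t *: ((v, 0) : Cvec R n)) e).
  apply: (@continuous_comp _ _ _ (fun v : 'rV[R]_n => (v, 0) : Cvec R n) ( *:%R t)).
    by apply: (@continuous_pair _ _ _ id (fun=> 0));
      [exact: cvg_id|exact: cst_continuous].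
  exact: scaler_continuous.
exact: exp_continuous he _.
Qed.

Lemma cplx_exp_i v : V v -> H (exp_i e v).
Proof. by move=> Vv; exists 1%g, v; split=> //; [case: sgK'|rewrite mul1g]. Qed.

Lemma sub_cplx k : K' k -> H k.
Proof. by move=> Kk; exists k, 0; rewrite (exp_i0 he) mulg1; split=> //;
  exact: imag0. Qed.

Lemma cplx_rho g : H g -> V (rho g).
Proof. by move=> [k [v [K'k Vv ->]]]; have [_ ->] := polar_unique v (sK'K K'k). Qed.

Lemma cplx_kappa g : H g -> K' (kappa g).
Proof. by move=> [k [v [K'k Vv ->]]]; have [-> _] := polar_unique v (sK'K K'k). Qed.

(** Sublevel sets are bounded: the Kempf-Ness function of x is proper on
    the symmetric space of the complexified subgroup. *)
Definition exhaustive x := forall c, exists B, forall v, V v ->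
  Psi x (exp_i e v) <= c -> `|v| <= B.

(** Positivity of the asymptotic slopes: a convex function on a half-line is
    unbounded exactly when its slope is eventually positive. *)
Definition unbounded_rays x := forall v, V v -> v != 0 ->
  forall c, exists2 t : R, 0 <= t & c < Psi x (exp_i e (t *: v)).

(** Rays start at the base point of the symmetric space, whereas the boundedness
    of sublevel sets does not refer to it; this equivalence is what allows x to
    be replaced by g x. *)
Lemma exhaustiveP x : exhaustive x <-> unbounded_rays x.
Proof.
split=> [ex v Vv v0 c|unb c].
  have [B HB] := ex c.
  have v_gt0 : 0 < `|v| by rewrite normr_gt0.
  pose t := (`|B| + 1) / `|v|.
  have t0 : 0 <= t by rewrite divr_ge0 // addr_ge0.
  exists t => //; rewrite ltNge; apply/negP => /(HB _ (imagZ t Vv)).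
  rewrite normrZ ger0_norm // /t divfK ?gt_eqF // => H1.
  by have := le_trans H1 (ler_norm B); rewrite gerDl ler10.
apply: (@ray_exhaustion R n (fun v => Psi x (exp_i e v)) V) unb c.
- exact: Psi_exp_i_continuous.
- exact: imag_closed.
- exact: imagZ.
- move=> v s t s0 st; have [f1 [df df1 f2 _ _]] := Psi_line x v.
  have := convex_le_max df df1 f2 s0 st.
  by rewrite scale0r.
Qed.

(** The Kempf-Ness functions of x and g x differ by a translation and a
    constant. If v is in a sublevel set for x, then the imaginary part v' of
    exp (i v) g^-1 is in one for g x, hence bounded, and v is recovered from v'
    by a continuous map. *)
Lemma exhaustive_act x g : H g -> exhaustive (act g x) -> exhaustive x.
Proof.
move=> Hg ex c.
have [B HB] := ex (c - Psi x g).
pose C := [set v : 'rV[R]_n | `|v| <= Num.max B 0].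
have cC : compact C.
  apply: bounded_closed_compact.
    exists (Num.max B 0); split; first exact: num_real.
    by move=> m Bm v Cv; exact: le_trans Cv (ltW Bm).
  apply: (@closed_comp _ _ (fun v : 'rV[R]_n => `|v|) [set r | r <= Num.max B 0]).
    by move=> v _; exact: norm_continuous.
  exact: closed_le.
have C0 : C !=set0 by exists 0; rewrite /C /= normr0 le_max lexx orbT.
pose F v := `|rho (exp_i e v * g)%g|.
have cF : continuous F.
  move=> v; apply: continuous_comp; last exact: norm_continuous.
  apply: continuous_comp; last exact: rho_cont.
  by apply: continuous_mulg; [exact: exp_i_cont|exact: cst_continuous].
have [v0 _ Hv0] := compact_EVT_max C0 cC (continuous_subspaceT cF).
exists (F v0) => v Vv vc.
pose h := (exp_i e v * g^-1)%g.
have Hh : H h by apply: HM; [exact: cplx_exp_i|exact: HV].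
have ch : Psi (act g x) (exp_i e (rho h)) <= c - Psi x g.
  rewrite -Psi_rho lerBrDl -PsiM /h mulgVK //.
have -> : v = rho (exp_i e (rho h) * g)%g.
  have [Kh Eh] := polar h.
  by rewrite -(rho_mulK _ Kh) mulgA -Eh /h mulgVK rho_exp_i.
apply: Hv0; rewrite inE /C /=; apply: le_trans (HB _ (cplx_rho Hh) ch) _.
by rewrite le_max lexx.
Qed.

Lemma exhaustive_actE x g : H g -> exhaustive x -> exhaustive (act g x).
Proof.
move=> Hg ex; apply: (@exhaustive_act _ g^-1%g); first exact: HV.
by rewrite -(actM hact) mulVg (act1 hact).
Qed.

(** At a zero of the momentum map in the orbit, the restriction of Psi to a
    line has zero slope at 0. If its second derivative at 0 were 0, exp (C v)
    would fix the point, and a conjugate of the complex line C v would lie in the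
    real form k, so that v = 0. Hence convex_unbounded applies. *)
Lemma stable_unbounded x : stable A e act Psi K' x -> unbounded_rays x.
Proof.
move=> [[g Hg mom] [h Hh AdK']]; apply/exhaustiveP/(exhaustive_act Hg)/exhaustiveP.
move=> v Vv v0 c; have [f1 [df df1 f2 f10 deg]] := Psi_line (act g x) v.
apply: (convex_unbounded df df1 f2); first by rewrite f10 mom.
apply: contra v0 => /eqP/deg stab; apply/eqP.
(* xi and J xi are tangent to the stabilizer of x, so Ad h maps both into k,
   where no nonzero vector has its multiple by i. *)
pose xi := Ad A e g^-1%g (v, 0).
have JE : (0, v) = Jc ((v, 0) : Cvec R n) by rewrite /Jc /= oppr0.
have lie_xi z : (forall t : R, H (e (t *: z))) ->
    (forall t : R, act (e (t *: z)) (act g x) = act g x) ->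
    lie_algebra e (H `&` [set g | act g x = x]) (Ad A e g^-1%g z).
  move=> Hz sz t; rewrite -(AdZ hG he) (exp_Ad hG he) invgK; split.
    by apply: HM => //; apply: HM => //; exact: HV.
  by rewrite /= !(actM hact) sz -(actM hact) mulVg (act1 hact).
have L1 : lie_algebra e K' (Ad A e h xi).
  apply: AdK'; exists xi => //; apply: lie_xi => t; first exact/sub_cplx/Vv.
  have := stab t 0; rewrite scale0r; congr (act (e _) _ = _).
  by apply: injective_projections => //=; rewrite scaler0.
have L2 : lie_algebra e K' (Ad A e h (Jc xi)).
  apply: AdK'; exists (Jc xi) => //; rewrite /xi -(AdJ hG he) -JE.
  apply: lie_xi => t; first by rewrite -exp_iZ; exact/cplx_exp_i/imagZ.
  have := stab 0 t; rewrite scale0r; congr (act (e _) _ = _).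
  by apply: injective_projections => //=; rewrite scaler0.
have K1' := (cplx_lie hK _).1 (fun t => sK'K (L1 t)).
have := (cplx_lie hK _).1 (fun t => sK'K (L2 t)).
rewrite (AdJ hG he) /= => K2'.
have := exp_Ad hG he h (Jc xi).
have -> : Ad A e h (Jc xi) = 0.
  by rewrite (AdJ hG he); apply: injective_projections; rewrite /= ?K1' ?K2' ?oppr0.
rewrite (exp0 he) => /(congr1 (fun z => h^-1 * z * h)%g).
rewrite mulg1 mulVg !mulgA mulVg mul1g mulgVK /xi -(AdJ hG he) -JE (exp_Ad hG he).
move=> /(congr1 (fun z => g * z * g^-1)%g).
rewrite invgK mulg1 mulgV !mulgA mulgV mul1g mulgK => E.
by have := rho_exp_i v; rewrite /exp_i -E -(exp_i0 he) rho_exp_i.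
Qed.

(** A proper function attains its minimum, and the momentum map vanishes at the
    corresponding point y of the orbit. If h = k exp (i v) fixes y, Psi y is
    minimal at both 1 and h, hence constant on the segment joining them; then
    exp (C v) fixes y and Psi y vanishes on the whole line, which contradicts
    properness unless v = 0. So the stabilizer of y is contained in K'. *)
Lemma unbounded_stable x : unbounded_rays x -> stable A e act Psi K' x.
Proof.
move=> unb; have ex := (exhaustiveP x).2 unb.
have [B HB] := ex 0.
pose C := [set v | V v /\ Psi x (exp_i e v) <= 0].
have cC : compact C.
  apply: bounded_closed_compact.
    exists B; split; first exact: num_real.
    by move=> m Bm v [Vv Cv]; exact: le_trans (HB v Vv Cv) (ltW Bm).
  apply: closedI; first exact: imag_closed.
  apply: (@closed_comp _ _ (fun v => Psi x (exp_i e v)) [set r | r <= 0]).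
    by move=> v _; exact: Psi_exp_i_continuous.
  exact: closed_le.
have C0 : C 0 by split; [exact: imag0|rewrite (exp_i0 he) Psi1].
have [v0] := compact_EVT_min (ex_intro _ _ C0) cC
  (continuous_subspaceT (@Psi_exp_i_continuous x)).
rewrite inE => -[Vv0 v00] min0.
pose g := exp_i e v0; pose y := act g x.
have Hg : H g by exact: cplx_exp_i.
(* Psi y h is the difference of Psi x between hg and its minimum point g. *)
have Psi_y_ge0 h : H h -> 0 <= Psi y h.
  move=> Hh; have Hhg := cplx_rho (HM Hh Hg).
  have : Psi x g <= Psi x (h * g)%g.
    rewrite [leRHS]Psi_rho; have [le0|gt0] :=
      leP (Psi x (exp_i e (rho (h * g)%g))) 0.
      by apply: min0; rewrite inE.
    exact: le_trans v00 (ltW gt0).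
  by rewrite PsiM lerDl.
have exy : exhaustive y by exact: exhaustive_actE.
have Psi_y1 : Psi y (exp_i e 0) = 0 by rewrite (exp_i0 he) Psi1.
have stab h : H h -> act h y = y -> K' h.
  move=> Hh hy.
  have h0 : Psi y h = 0.
    apply/eqP; rewrite eq_le Psi_y_ge0 // andbT.
    have := PsiM y h h^-1%g; rewrite hy mulVg Psi1 => /esym/eqP.
    by rewrite addr_eq0 => /eqP ->; rewrite oppr_le0 Psi_y_ge0 //; exact: HV.
  have rho0 : rho h = 0.
    apply: contrapT => /eqP r0.
    have Vr := cplx_rho Hh.
    have [f1 [df df1 f2 _ deg]] := Psi_line y (rho h).
    have flat : derive1 f1 0 = 0.
      apply: (convex_flat df df1 ltr01) => t t0 t1.
      apply/eqP; rewrite scale0r Psi_y1 eq_le Psi_y_ge0 ?andbT;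
        last exact/cplx_exp_i/imagZ.
      have := convex_le_max df df1 f2 t0 t1.
      by rewrite scale0r scale1r Psi_y1 -Psi_rho h0 maxxx.
    have fixe t : act (exp_i e (t *: rho h)) y = y.
      have := deg.1 flat 0 t; rewrite scale0r; exact.
    have [t _] := (exhaustiveP y).1 exy (rho h) Vr r0 0.
    apply/negP; rewrite -leNgt.
    have := PsiM y (exp_i e (t *: rho h)) (exp_i e (- t *: rho h)).
    rewrite fixe -(exp_iDl he) addNr scale0r Psi_y1 => /esym/eqP.
    rewrite addr_eq0 => /eqP ->; rewrite oppr_le0 Psi_y_ge0 //.
    exact/cplx_exp_i/imagZ.
  by have [_ ->] := polar h; rewrite rho0 (exp_i0 he) mulg1; exact: cplx_kappa.
split; exists g => //.
- move=> v Vv; have [f1 [df df1 f2 f10 _]] := Psi_line y v.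
  rewrite -/y -f10.
  have [||||D0 E0] := @derive1_at_min R (fun t : R => Psi y (exp_i e (t *: v)))
    (-1) 1 0.
  + by rewrite -subr_ge0 opprK addr_ge0.
  + by move=> t _; case: (df t).
  + by rewrite in_itv /= ltrN10 ltr01.
  + by move=> t _; rewrite scale0r Psi_y1; exact/Psi_y_ge0/cplx_exp_i/imagZ.
  + by have [_ E1] := df 0; exact: etrans (esym E1) E0.
- move=> _ [xi xiL <-] t.
  rewrite -(AdZ hG he) (exp_Ad hG he); have [Hxi /= sxi] := xiL t.
  apply: stab; first by apply: HM => //; [exact: HM|exact: HV].
  by rewrite /y -(actM hact) mulgVK (actM hact) sxi.
Qed.

Lemma stableP x : stable A e act Psi K' x <-> unbounded_rays x.
Proof. by split; [exact: stable_unbounded|exact: unbounded_stable]. Qed.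
End restriction.

End KempfNess.

(** * Stability and compact tori *)

Unset Implicit Arguments.

Theorem corollary3p8 (R : realType) (n : nat)
  (G : topologicalGroupType) (A : set (chart R n G)) (e : Cvec R n -> G)
  (K : set G) (ip : 'rV[R]_n -> 'rV[R]_n -> R)
  (M : topologicalType) (act : G -> M -> M) (Psi : M -> G -> R)
  (hG : complex_Lie_group A) (he : exponential A e)
  (hK : complexification e K) (hip : Ad_invariant_product A e K ip)
  (hM : hausdorff_space M) (hact : group_action act)
  (hPsi : Kempf_Ness A e act K ip Psi) (x : M) :
  stable A e act Psi K x <->
  (forall T : set G, compact_torus T -> T `<=` K -> stable A e act Psi T x).
Proof.
have [kappa [rho [_ rho_cont polar polar_unique]]] := cplx_polar hK.
have cl C : compact C -> closed C := compact_closed (clg_hausdorff hG) (A := C).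
have cplxK g : cplx e K g.
  have [Kg Eg] := polar g; exists (kappa g), (rho g); split=> //.
  exact: (cplx_lie hK (rho g, 0)).2.
have KP := stableP hG he hact hPsi rho_cont polar polar_unique hK (K' := K)
  (fun _ => id) (cplx_subgroup hK) (cl _ (cplx_compact hK))
  (fun g h _ _ => cplxK _) (fun g _ => cplxK _) x.
have TP T : compact_torus T -> T `<=` K ->
    stable A e act Psi T x <-> unbounded_rays e Psi T x.
  move=> [sgT coT _ abT] TK.
  exact: (stableP hG he hact hPsi rho_cont polar polar_unique hK TK sgT (cl _ coT)
    (torus_cplxM hG he sgT abT) (torus_cplxV hG he sgT abT)).
split=> [/KP unb T tT TK|Tst].
  by apply/(TP T tT TK) => v Vv; apply: unb => t; apply: TK; exact: Vv.
apply/KP => v _ v0 c.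
have [T [tT TK Tv]] := line_torus hG he hK v.
exact: (TP T tT TK).1 (Tst T tT TK) v Tv v0 c.
Qed.
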